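(* Let $d\ge1$, let $\mathbf r=(r_1,\dots,r_d)$ be a vector of nonnegative integers and $k$ an integer such that $$r_d\ge 2r_{d-1}\ge 4r_{d-2}\ge\cdots\ge 2^{d-1}r_1,\qquad k\ge 2r_d+1.$$ Let $\mathcal T$ be a conforming simplicial triangulation of a domain $\Omega\subset\mathbb R^d$ and $K\in\mathcal T$ a $d$-simplex. For $u\in\mathcal P_k(K)$ consider the degrees of freedom $$\frac1{|F|}\langle D^\theta u,v\rangle_F\qquad\text{for all } v\in\mathcal B_{F,n,k},$$ for all subsimplices $F$ of $K$ (with $s$ denoting the codimension of $F$), all $n=0,1,\dots,r_s$ (only $n=0$ when $s=0$), and all $\theta\in\mathbb N_0^s$ with $|\theta|=n$. These degrees of freedom are unisolvent for $\mathcal P_k(K)$. Moreover, the global finite element space $$\{u\in L^2(\Omega): u|_K\in\mathcal P_k(K)\ \forall K\in\mathcal T,\ u\text{ is single-valued for each degree of freedom on any subsimplex }F\text{ of dimension}\le d-1\}$$ lies in $C^{r_1}(\Omega)$. Here single-valued on $F$ means that for any two $d$-simplices $K^+,K^-\in\mathcal T$ sharing the common subsimplex $F$, of codimension $s$, one has $\frac1{|F|}\langle D^\theta u|_{K^+},v\rangle_F=\frac1{|F|}\langle D^\theta u|_{K^-},v\rangle_F$ for all $0\le n\le r_s$, all $|\theta|=n$ and all $v\in\mathcal B_{F,n,k}$.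
   Context: $\mathcal P_k(K)$ is the space of polynomials of degree $\le k$ on $K$. A subsimplex of $K$ is the convex hull of a nonempty subset of its vertices $\mathbf x_0,\dots,\mathbf x_d$. Let $F=\operatorname{conv}\{\mathbf x_i:i\in\Delta\}$ with $\Delta\subseteq\{0,\dots,d\}$ nonempty, of codimension $s=d+1-\operatorname{Card}(\Delta)$, and let $\lambda_{F,i}$, $i\in\Delta$, be the barycentric coordinates of $F$ (restrictions to $F$ of the barycentric coordinates of $K$). The bubble space is $$\mathcal B_{F,n,k}:=\operatorname{span}\Big\{\prod_{i\in\Delta}\lambda_{F,i}^{\sigma_i}:\sigma=(\sigma_i)_{i\in\Delta}\in\Sigma_0^{(\mathbf q)}(\Delta,k-n)\Big\},\qquad \mathbf q=(q_1,\dots,q_{d-s})=(r_{s+1}-n,\dots,r_d-n),$$ where $\Sigma_0^{(\mathbf q)}(\Delta,m)$ is the set of $\sigma\in\mathbb N_0^{\Delta}$ with $\sum_{i\in\Delta}\sigma_i=m$ and $\sigma_{j_1}+\cdots+\sigma_{j_l}>q_l$ for all subsets $\{j_1,\dots,j_l\}\subsetneq\Delta$ of cardinality $l$, $l=1,\dots,d-s$ (no condition of the latter kind if $\operatorname{Card}(\Delta)=1$). For each subsimplex $F$ of $\mathcal T$ of codimension $s$, orthonormal normal vectors $\mathbf n_{F,0},\dots,\mathbf n_{F,s-1}$ of $F$ are fixed (the same for all elements containing $F$), and for $\theta=(\theta_0,\dots,\theta_{s-1})\in\mathbb N_0^s$ with $|\theta|=\sum\theta_i=n$, $$D^\theta u:=\frac{\partial^n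 u}{\partial\mathbf n_{F,0}^{\theta_0}\cdots\partial\mathbf n_{F,s-1}^{\theta_{s-1}}},$$ with $D^\theta u=u$ when $n=0$. Also $\frac1{|F|}\langle f,g\rangle_F:=\frac1{|F|}\int_F fg$ if $F$ is not a vertex and $:=f(F)g(F)$ if $F$ is a vertex. On a vertex, the single barycentric coordinate is the constant $1$. For each $(F,\theta)$ the number of degrees of freedom is $\dim\mathcal B_{F,n,k}$ ($v$ runs over a basis). Unisolvent means that the total number of degrees of freedom equals $\dim\mathcal P_k(K)$ and the only $u\in\mathcal P_k(K)$ on which all of them vanish is $u=0$. Membership in $C^{r_1}(\Omega)$ is understood up to modification on a set of measure zero. *)

(* Defs.v *)
From HB Require Import structures.
From mathcomp Require Import all_boot all_order all_algebra.
From mathcomp Require Import finmap.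
From mathcomp Require Import all_classical all_reals all_analysis.

Set Implicit Arguments.
Unset Strict Implicit.
Unset Printing Implicit Defensive.

Import Order.TTheory GRing.Theory Num.Theory.
Import numFieldNormedType.Exports.

Local Open Scope classical_set_scope.
Local Open Scope ring_scope.

(** * Lebesgue measure on [R^m] *)

(* MathComp-Analysis has the product sigma-algebra on [m.-tuple R] but no
   Lebesgue measure on it: it is built here as an iterated product. *)
Section lebesgue_step.
Context {R : realType} (m : nat).
Variable mu : {sigma_finite_measure set (m.-tuple R) -> \bar R}.

Definition tcons (p : measurableTypeR R * m.-tuple R) : m.+1.-tuple R :=
  [tuple of p.1 :: p.2].

Let measurable_tcons : measurable_fun [set: _] tcons.
Proof. exact: measurable_cons. Qed.

HB.instance Definition _ :=
  @isMeasurableFun.Build _ _ _ _ tcons measurable_tcons.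

Definition lebesgue_step : set (m.+1.-tuple R) -> \bar R :=
  pushforward (lebesgue_measure \x mu)%E tcons.

Let lebesgue_step0 : lebesgue_step set0 = 0%E.
Proof. exact: measure0. Qed.

Let lebesgue_step_ge0 A : (0 <= lebesgue_step A)%E.
Proof. exact: measure_ge0. Qed.

Let lebesgue_step_sigma_additive : semi_sigma_additive lebesgue_step.
Proof. exact: measure_semi_sigma_additive. Qed.

HB.instance Definition _ := isMeasure.Build _ _ _ lebesgue_step
  lebesgue_step0 lebesgue_step_ge0 lebesgue_step_sigma_additive.

Let tuncons (t : m.+1.-tuple R) : measurableTypeR R * m.-tuple R :=
  (tnth t ord0, [tuple of behead t]).

Let measurable_tuncons : measurable_fun [set: _] tuncons.
Proof.
apply/measurable_fun_pair; first exact: measurable_tnth.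
exact: measurable_behead.
Qed.

Let tconsK : cancel tcons tuncons.
Proof. by move=> [x t]; congr pair; apply/val_inj. Qed.

Let lebesgue_step_sigma_finite : sigma_finite setT lebesgue_step.
Proof.
have /sigma_finiteP[F [FT ndF Foo]] := sigma_finiteT (@lebesgue_measure R).
have /sigma_finiteP[G [GT ndG Goo]] := sigma_finiteT mu.
exists (fun i => tuncons @^-1` (F i `*` G i)).
  rewrite -preimage_bigcup; apply/esym/seteqP; split => // t _ /=.
  have [i _ Fi] : (\bigcup_i F i) (tuncons t).1 by rewrite -FT.
  have [j _ Gj] : (\bigcup_i G i) (tuncons t).2 by rewrite -GT.
  exists (maxn i j) => //; split.
    by move: Fi; exact/subsetPset/ndF/leq_maxl.
  by move: Gj; exact/subsetPset/ndG/leq_maxr.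
move=> i; have [mFi Fioo] := Foo i; have [mGi Gioo] := Goo i.
have mFG : measurable (F i `*` G i) by exact: measurableX.
split; first by rewrite -[X in measurable X]setTI; exact: measurable_tuncons.
have -> : lebesgue_step (tuncons @^-1` (F i `*` G i)) =
    (lebesgue_measure \x mu)%E (F i `*` G i).
  rewrite /lebesgue_step /pushforward -comp_preimage.
  suff -> : tuncons \o tcons = id by rewrite preimage_id.
  exact/funext/tconsK.
by rewrite product_measure1E// lte_mul_pinfty// ge0_fin_numE.
Qed.

HB.instance Definition _ := Measure_isSigmaFinite.Build _ _ _ lebesgue_step
  lebesgue_step_sigma_finite.

End lebesgue_step.

Fixpoint lebesgue_tuple {R : realType} (m : nat) :
    {sigma_finite_measure set (m.-tuple R) -> \bar R} :=
  match m with
  | 0 => \d_([tuple] : 0.-tuple R)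
  | m'.+1 => lebesgue_step (lebesgue_tuple m')
  end.

Definition row_of_tuple {R : realType} {m : nat} (t : m.-tuple R) : 'rV[R]_m :=
  \row_i tnth t i.

(** * Spans and dimensions in a (possibly infinite dimensional) space *)

Section span.
Context {R : realType} {V : lmodType R}.

Definition lspan (S : set V) : set V :=
  [set v | exists n (c : 'I_n -> R) (e : 'I_n -> V),
     (forall i, S (e i)) /\ v = \sum_i c i *: e i].

Definition lin_indep n (e : 'I_n -> V) : Prop :=
  forall c : 'I_n -> R, \sum_i c i *: e i = 0 -> forall i, c i = 0.

Definition has_dim (U : set V) (n : nat) : Prop :=
  exists2 e : 'I_n -> V, lin_indep e & U = lspan (range e).

(* junk value 0 when [U] is not a finite dimensional subspace *)
Definition fdim (U : set V) : nat := xget 0%N [set n | has_dim U n].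

End span.

(** * Simplices, given by their finite sets of vertices *)

Section simplices.
Context {R : realType} {d : nat}.
Implicit Types (F K : {fset 'rV[R]_d}).

Definition aff_indep F : Prop :=
  forall c : F -> R, \sum_x c x = 0 -> \sum_x c x *: val x = 0 ->
    forall x, c x = 0.

Definition nondegenerate_simplex K : Prop := #|` K| = d.+1 /\ aff_indep K.

(* convex hull of the vertices *)
Definition simplex F : set 'rV[R]_d :=
  [set y | exists c : F -> R,
     [/\ forall x, 0 <= c x, \sum_x c x = 1 & y = \sum_x c x *: val x]].

Definition codim F : nat := (d.+1 - #|` F|)%N.

Definition subsimplex F K : Prop := (F `<=` K)%fset /\ F != fset0.

(* [bary F y x] is the coordinate of [y] with respect to the vertex [x]; it is
   meaningful when [F] is affinely independent and [y] is in its affine hull *)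
Definition bary F (y : 'rV[R]_d) : {ffun F -> R} :=
  xget 0 [set l : {ffun F -> R} | \sum_x l x = 1 /\ \sum_x l x *: val x = y].

Definition is_normal_frame F (N : 'M[R]_(codim F, d)) : Prop :=
  N *m N^T = 1%:M /\
  {in F &, forall x y, (x - y) *m N^T = 0}.

End simplices.

(** * Integration on a simplex *)

Section face_integral.
Context {R : realType} {d : nat}.
Implicit Types (F : {fset 'rV[R]_d}) (f g : 'rV[R]_d -> R).

Definition unit_simplex (m : nat) : set (m.-tuple R) :=
  [set t | (forall i, 0 <= tnth t i) /\ \sum_i tnth t i <= 1].

Definition vertex F (i : nat) : 'rV[R]_d := nth 0 (enum_fset F) i.

Definition face_dim F : nat := #|` F|.-1.

Definition edge_mx F : 'M[R]_(face_dim F, d) :=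
  \matrix_(i < face_dim F) (vertex F i.+1 - vertex F 0).

(* surface integral, through the affine parametrization of [F] by the unit
   simplex, whose area element is the square root of the Gram determinant *)
Definition face_integral F f : R :=
  Num.sqrt (\det (edge_mx F *m (edge_mx F)^T)) *
  \int[lebesgue_tuple (face_dim F)]_(t in @unit_simplex (face_dim F))
     f (vertex F 0 + row_of_tuple t *m edge_mx F).

(* the normalized pairing [<f, g>_F / |F|] *)
Definition face_pairing F f g : R :=
  if #|` F| == 1%N then f (vertex F 0) * g (vertex F 0)
  else (face_integral F (cst 1))^-1 * face_integral F (f \* g).

End face_integral.

(** * Polynomials, bubbles and degrees of freedom *)

Section dofs.
Context {R : realType} {d : nat}.
Implicit Types (F K : {fset 'rV[R]_d}) (u f : 'rV[R]_d -> R).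
Implicit Types (r : nat -> nat).

(* A polynomial on a nondegenerate simplex is identified with its unique
   polynomial extension to the whole space. *)
Definition poly_space (k : nat) : set ('rV[R]_d -> R) :=
  lspan [set f : 'rV[R]_d -> R | exists2 a : 'I_d -> nat,
    (\sum_i a i <= k)%N & f = fun x => \prod_i x 0 i ^+ a i].

(* The values [q l] matter only for [1 <= l < #|Delta|]. *)
Definition Sigma0 (Delta : finType) (q : nat -> nat) (m : nat) :
    set (Delta -> nat) :=
  [set sigma | (\sum_i sigma i = m)%N /\
     forall J : {set Delta}, J != finset.set0 -> J \proper finset.setT ->
       (q #|J| < \sum_(j in J) sigma j)%N].

(* The truncated subtractions are exact for [n <= r (codim F) <= k] and [r]
   nondecreasing.  Functions on [F] are extended by zero outside [F]. *)
Definition bubble r (k : nat) F (n : nat) : set ('rV[R]_d -> R) :=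
  lspan [set f : 'rV[R]_d -> R | exists2 sigma : F -> nat,
    Sigma0 (fun l => (r (codim F + l) - n)%N) (k - n) sigma &
    f = (fun y => \prod_(x : F) bary F y x ^+ sigma x) \_ (simplex F)].

(* [r] is indexed from 1 *)
Definition max_order r (s : nat) : nat := if s is 0 then 0%N else r s.

Definition normal_derive s (N : 'M[R]_(s, d)) (theta : 'I_s -> nat) u :
    'rV[R]_d -> R :=
  foldr (fun j f => iter (theta j) (fun g => 'D_(row j N) g) f) u (enum 'I_s).

Definition num_multi_index (s n : nat) : nat :=
  #|[pred theta : {ffun 'I_s -> 'I_n.+1} | \sum_j theta j == n]%N|.

Definition num_dofs r (k : nat) K : nat :=
  (\sum_(F <- enum_fset (fpowerset K) | F != fset0)
     \sum_(n < (max_order r (codim F)).+1)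
       num_multi_index (codim F) n * fdim (bubble r k F n))%N.

Variable nu : forall F : {fset 'rV[R]_d}, 'M[R]_(codim F, d).

Definition dof F (theta : 'I_(codim F) -> nat) u v : R :=
  face_pairing F (normal_derive (nu F) theta u) v.

Definition unisolvent r (k : nat) K : Prop :=
  num_dofs r k K = fdim (poly_space k) /\
  forall u, poly_space k u ->
    (forall F n (theta : 'I_(codim F) -> nat) v,
       subsimplex F K -> (n <= max_order r (codim F))%N ->
       (\sum_j theta j)%N = n -> bubble r k F n v ->
       dof theta u v = 0) ->
    u = 0.

(* [u] and [w] are the polynomials carried by two simplices containing [F] *)
Definition same_dofs r (k : nat) F u w : Prop :=
  forall n (theta : 'I_(codim F) -> nat) v,
    (n <= max_order r (codim F))%N -> (\sum_j theta j)%N = n ->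
    bubble r k F n v -> dof theta u v = dof theta w v.

End dofs.

(** * Triangulations and function spaces on a domain *)

Section global.
Context {R : realType} {d : nat}.
Implicit Types (Omega : set 'rV[R]_d) (T : set {fset 'rV[R]_d}).
Implicit Types (u w : 'rV[R]_d -> R).

Definition is_domain Omega : Prop :=
  [/\ open Omega, connected Omega & Omega !=set0].

(* [T] is the set of vertex sets of the [d]-simplices. Local finiteness covers
   finite triangulations as well as triangulations of unbounded domains. *)
Definition conforming_triangulation Omega T : Prop :=
  [/\ forall K, T K -> nondegenerate_simplex K,
      closure Omega = \bigcup_(K in T) simplex K,
      forall K K', T K -> T K' ->
        simplex K `&` simplex K' = set0 \/
        exists F, [/\ subsimplex F K, subsimplex F K' &
                      simplex K `&` simplex K' = simplex F]
    & forall y : 'rV[R]_d, exists2 U, nbhs y U &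
        finite_set [set K | T K /\ simplex K `&` U !=set0] ].

Definition ae_eq_on (D : set 'rV[R]_d) u w : Prop :=
  {ae lebesgue_tuple d, forall t : d.-tuple R,
     D (row_of_tuple t) -> u (row_of_tuple t) = w (row_of_tuple t)}.

Definition square_integrable Omega u : Prop :=
  ((u \_ Omega) \o row_of_tuple : d.-tuple R -> R)
    \in Lfun (lebesgue_tuple d) 2%:E.

(* The polynomial [p K] is the restriction of [u] to [K], up to null sets. *)
Definition fe_space (r : nat -> nat) (k : nat)
    (nu : forall F : {fset 'rV[R]_d}, 'M[R]_(codim F, d)) Omega T :
    set ('rV[R]_d -> R) :=
  [set u | square_integrable Omega u /\
     exists p : {fset 'rV[R]_d} -> 'rV[R]_d -> R,
       (forall K, T K -> poly_space k (p K) /\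
          ae_eq_on (Omega `&` simplex K) u (p K)) /\
       (forall K K' F, T K -> T K' -> subsimplex F K -> subsimplex F K' ->
          (#|` F| <= d)%N -> same_dofs nu r k F (p K) (p K'))].

Fixpoint cont_diff (m : nat) Omega u : Prop :=
  (forall x, Omega x -> {for x, continuous u}) /\
  if m is m'.+1 then
    forall i : 'I_d, (forall x, Omega x -> derivable u x (delta_mx 0 i)) /\
      cont_diff m' Omega ('D_(delta_mx 0 i) u)
  else True.

End global.

(* Main.v *)
(* On a simplex [K], expand a polynomial of degree at most [k] in the Bernstein
   basis [lambda^al], [|al| = k].  For a set [C] of vertices write [al(C)] for
   the partial sum of [al] over [C], and call [C], not the set of all vertices,
   admissible for [al] if [al(C) <= r_|C|].  As [2 r_i <= r_(i+1)] and
   [k > 2 r_d], the union of two incomparable admissible sets is admissible,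
   so [al] has a unique maximal admissible set, the complement of a face [F].
   Splitting [al] into its parts outside and inside [F] yields a multi-index
   [theta], [|theta| = n <= r_s], and an exponent in the index set of the bubble
   space of [(F, n)]: this is the count of the degrees of freedom.
   Unisolvence is by induction on the dimension of [F] and then on [n].  If the
   coefficients of [u] vanish for all [al] that are admissible for a smaller
   face, or of order less than [n] on [F], then [D^theta u] restricted to [F] is
   itself a bubble function.  Testing it against itself gives [D^theta u = 0] on
   [F], and since the barycentric coordinates outside [F] restrict to linear
   coordinates of the normal space, the coefficients of order [n] vanish.
   For two simplices sharing the face [F] the same induction, which involves
   the faces of [F] only, applies to the difference of the two polynomials: it
   vanishes to order [r_s + 1 > r_1] along [F], so the pieces glue to a [C^r_1]
   function. *)
Require Import Defs.
From mathcomp Require Import all_boot all_order all_algebra.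
From mathcomp Require Import finmap.
From mathcomp Require Import zify.

Set Implicit Arguments.
Unset Strict Implicit.
Unset Printing Implicit Defensive.

(** * Multi-indices and faces *)

(** The degrees of freedom are integrals over faces, while the unknowns are the Bernstein
    coefficients on K. The link is the normal fibre t -> y + t N through a point y of F. Along it
    the barycentric coordinates of the vertices outside F are linear forms in t that do not depend
    on y, and the others equal their values at y up to terms vanishing at t = 0. Hence a Bernstein
    polynomial has on the fibre the leading form (Bernstein polynomial on F at y) times (form in t
    of degree al(outside F)), and derivatives at t = 0 of at most that order see nothing else. The
    outside vertices are as many as the normal directions, so these linear forms can take any
    prescribed values. Combined with the points of F, they give arbitrary positive arguments to a
    polynomial homogeneous in two groups of variables, and such values determine its coefficients.
    Of integration only two facts are needed: linearity, and that a polynomial with zero square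
    integral vanishes in the interior of the simplex. *)

Section orders.
Variables (d : nat) (r : nat -> nat) (k : nat).
Hypothesis r_growth : forall i, (1 <= i < d)%N ->
  (2 ^ (d - i) * r i <= 2 ^ (d - i.+1) * r i.+1)%N.
Hypothesis k_large : (2 * r d + 1 <= k)%N.

Lemma order_double i j : (1 <= i)%N -> (i < j)%N -> (j <= d)%N -> (2 * r i <= r j)%N.
Proof.
move=> i1; elim: j => [//|j IH]; rewrite ltnS leq_eqVlt => /orP[/eqP <-|ij] jd.
  have := r_growth (i := i); rewrite i1 jd => /(_ isT).
  by rewrite -subnSK// expnSr -mulnA leq_pmul2l// expn_gt0.
apply: leq_trans (IH ij (ltnW jd)) _.
have := r_growth (i := j); rewrite jd (leq_trans i1 (ltnW ij)) => /(_ isT).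
rewrite -subnSK// expnSr -mulnA leq_pmul2l ?expn_gt0//; apply: leq_trans.
by rewrite leq_pmull.
Qed.

Lemma order_mono i j : (1 <= i)%N -> (i <= j)%N -> (j <= d)%N -> (r i <= r j)%N.
Proof.
move=> i1; rewrite leq_eqVlt => /orP[/eqP ->//|ij jd].
by apply: leq_trans (order_double i1 ij jd); rewrite leq_pmull.
Qed.

Lemma max_order_le s t : (s <= t)%N -> (1 <= t <= d)%N -> (max_order r s <= r t)%N.
Proof. by case: s => // s st /andP[t1 td]; apply: order_mono. Qed.

Lemma max_order_ltk s : (s <= d)%N -> (max_order r s <= k)%N.
Proof.
case: s => // s sd; have := order_mono (isT : (1 <= s.+1)%N) sd (leqnn d).
rewrite /max_order; lia.
Qed.

Lemma sum_setU_le (I : finType) (f : I -> nat) (A B : {set I}) :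
  (\sum_(x in A :|: B) f x <= \sum_(x in A) f x + \sum_(x in B) f x)%N.
Proof.
rewrite big_mkcond [X in (_ <= X + _)%N]big_mkcond [X in (_ <= _ + X)%N]big_mkcond.
rewrite -big_split; apply: leq_sum => x _; rewrite inE /=.
by case: (x \in A); case: (x \in B); rewrite ?leq_addr.
Qed.

Lemma sum_setU_disjoint (I : finType) (f : I -> nat) (A B : {set I}) :
  [disjoint A & B] ->
  (\sum_(x in A :|: B) f x = \sum_(x in A) f x + \sum_(x in B) f x)%N.
Proof. by move=> AB; rewrite -bigU//; apply: eq_bigl => x; rewrite inE. Qed.

Section faces.
Variables (I : finType) (al : I -> nat).
Hypothesis card_I : #|I| = d.+1.
Hypothesis al_k : (\sum_x al x = k)%N.

(* [~: D] is a maximal admissible set of vertices for [al]. *)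
Definition face_cond (D : {set I}) : bool :=
  [&& D != set0, (\sum_(x in ~: D) al x <= max_order r #|~: D|)%N &
    [forall J : {set I}, (J \subset D) ==> (J != set0) ==> (J != D) ==>
      (r (#|~: D| + #|J|) < \sum_(x in ~: D) al x + \sum_(x in J) al x)%N]].

(** Admissibility. As [max_order r 0] is 0, the empty set qualifies, so a maximal admissible set
    exists. *)
Let good (C : {set I}) := (C != setT) &&
  (\sum_(x in C) al x <= max_order r #|C|)%N.

Let card_lt (C : {set I}) : C != setT -> (#|C| <= d)%N.
Proof.
move=> CT; rewrite -ltnS -card_I -cardsT; apply: proper_card.
by rewrite properT.
Qed.

Lemma face_cond_good D : face_cond D -> good (~: D).
Proof.
by case/and3P => D0 Dg _; rewrite /good Dg andbT; apply: contraNneq D0 => e;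
  rewrite -[D]setCK e setCT.
Qed.

Lemma face_cond_max D (C : {set I}) : face_cond D -> good C -> ~: D \subset C -> C = ~: D.
Proof.
case/and3P => _ _ /forallP DJ /andP[CT Cg] DC; apply/eqP; rewrite eqEsubset DC andbT.
have CE : C = ~: D :|: (C :&: D).
  by apply/setP => x; rewrite !inE; have := subsetP DC x; rewrite inE;
    case: (x \in D) => //= [_|->//]; rewrite andbT.
have dis : [disjoint ~: D & C :&: D].
  by rewrite -setI_eq0; apply/eqP/setP => x; rewrite !inE; case: (x \in D); rewrite ?andbF.
have cC : #|C| = (#|~: D| + #|C :&: D|)%N.
  by rewrite {1}CE cardsU (disjoint_setI0 dis) cards0 subn0.
have sC : (\sum_(x in C) al x = \sum_(x in ~: D) al x + \sum_(x in C :&: D) al x)%N.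
  by rewrite {1}CE sum_setU_disjoint.
have [J0|J0] := eqVneq (C :&: D) set0.
  by rewrite CE J0 setU0.
have JD : C :&: D != D.
  apply: contraNneq CT => e; rewrite CE e; apply/eqP/setP => x.
  by rewrite !inE orNb.
have := DJ (C :&: D); rewrite subsetIr J0 JD /= -cC -sC.
(* [max_order r] and [r] can differ only at 0, and this cardinal is positive because [C :&: D] is
   not empty. *)
rewrite ltnNge => /negP; case; move: Cg; rewrite cC.
by move: J0; rewrite -card_gt0; case: #|_ :&: _| => // n _; rewrite addnS.
Qed.

Lemma face_cond_exists : exists D, face_cond D.
Proof.
have g0 : good set0.
  rewrite /good big_set0 andbT; apply/eqP => e.
  by move: card_I; rewrite -cardsT -e cards0.
have [C /maxsetP[Cg Cmax] _] := maxset_exists g0.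
exists (~: C); rewrite /face_cond setCK; case/andP: (Cg) => CT ->.
rewrite andTb; apply/andP; split.
  by apply: contraNneq CT => e; rewrite -[C]setCK e setC0.
apply/forallP => J; apply/implyP => JC; apply/implyP => J0; apply/implyP => JC'.
have dis : [disjoint C & J] by rewrite disjoint_sym disjoints_subset.
have cC : #|C :|: J| = (#|C| + #|J|)%N.
  by rewrite cardsU (disjoint_setI0 dis) cards0 subn0.
have sC : (\sum_(x in C :|: J) al x = \sum_(x in C) al x + \sum_(x in J) al x)%N.
  by rewrite sum_setU_disjoint.
rewrite ltnNge -cC -sC; apply: contraNN (J0) => le.
have := Cmax (C :|: J); rewrite subsetUl => /(_ _ isT) CJ.
have {CJ} CJ : C :|: J = C.
  apply: CJ; apply/andP; split.
    apply: contraNneq JC' => e; rewrite eqEsubset JC; apply/subsetP => x.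
    by rewrite inE => xC; have := in_setT x; rewrite -e inE (negbTE xC).
  move: J0 le; rewrite -card_gt0 cC; case: #|J| => // n _; rewrite addnS.
  by [].
rewrite -subset0 -(disjoint_setI0 dis) subsetI subxx andbT.
by apply: subset_trans (subsetUr C J) _; rewrite CJ.
Qed.

Lemma face_cond_uniq D D' : face_cond D -> face_cond D' -> D = D'.
Proof.
move=> cD cD'; have gD := face_cond_good cD; have gD' := face_cond_good cD'.
apply: setC_inj.
pose U := ~: D :|: ~: D'.
have [sub|nsub] := boolP (~: D \subset ~: D'); first by rewrite (face_cond_max cD gD' sub).
have [sub|nsub'] := boolP (~: D' \subset ~: D).
  by rewrite (face_cond_max cD' gD sub).
have ltD : (#|~: D| < #|U|)%N.
  apply: proper_card; rewrite properE subsetUl subUset subxx.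
  by rewrite (negbTE nsub').
have ltD' : (#|~: D'| < #|U|)%N.
  apply: proper_card; rewrite properE subsetUr subUset subxx andbT.
  by rewrite (negbTE nsub).
case/andP: (gD) => TD leD; case/andP: (gD') => TD' leD'.
have D1 : (0 < #|~: D|)%N.
  by rewrite card_gt0; apply: contraNneq nsub => ->; exact: sub0set.
have D1' : (0 < #|~: D'|)%N.
  by rewrite card_gt0; apply: contraNneq nsub' => ->; exact: sub0set.
have sU : (\sum_(x in U) al x <= \sum_(x in ~: D) al x + \sum_(x in ~: D') al x)%N.
  exact: sum_setU_le.
have sT : (\sum_(x in [set: I]) al x = k)%N.
  by rewrite -al_k; apply: eq_bigl => x; rewrite inE.
have UT : U != setT.
  apply: contraTneq k_large => UT; move: sU leD leD'; rewrite UT sT.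
  have := order_mono D1 (card_lt TD) (leqnn d).
  have := order_mono D1' (card_lt TD') (leqnn d).
  case: #|~: D| D1 => // n _; case: #|~: D'| D1' => // n' _; rewrite /max_order; lia.
have gU : good U.
  rewrite /good UT; apply: leq_trans sU _.
  (* Each partial sum is at most [r m], and incomparability makes m smaller than [#|U|]; doubling
     then absorbs the sum of the two. *)
  pose m := maxn #|~: D| #|~: D'|.
  have mU : (m < #|U|)%N by rewrite gtn_max ltD ltD'.
  have := order_double (leq_trans D1 (leq_maxl _ _ : _ <= m)%N) mU (card_lt UT).
  have := order_mono D1 (leq_maxl _ _ : _ <= m)%N (leq_trans (ltnW mU) (card_lt UT)).
  have := order_mono D1' (leq_maxr _ _ : _ <= m)%N (leq_trans (ltnW mU) (card_lt UT)).
  move: leD leD'; case: #|~: D| D1 => // n _; case: #|~: D'| D1' => // n' _.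
  case: #|U| mU => // p _; rewrite /max_order; lia.
by rewrite -(face_cond_max cD gU (subsetUl _ _))
  -(face_cond_max cD' gU (subsetUr _ _)).
Qed.
End faces.

(** A finite version of [Sigma0], made for counting: exponents of total at most k fit into
    ['I_k.+1]. *)
Definition bubble_index (I : finType) m (q : nat -> nat) :
    pred {ffun I -> 'I_k.+1} :=
  fun al => (\sum_x al x == m)%N &&
    [forall J : {set I}, (J != set0) ==> (J \proper [set: I]) ==>
       (q #|J| < \sum_(j in J) al j)%N].

Lemma bubble_indexP (I : finType) m q (al : {ffun I -> 'I_k.+1}) :
  reflect (Sigma0 q m (fun x => val (al x))) (bubble_index m q al).
Proof.
apply: (iffP andP) => [[/eqP am /forallP aJ]|[am aJ]]; split=> //.
- by move=> J J0 JT; move: (aJ J); rewrite J0 JT.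
- exact/eqP.
- by apply/forallP => J; apply/implyP => J0; apply/implyP => JT; exact: aJ.
Qed.

(** * Counting the multi-indices that belong to one face and one order *)

Section face_count.
Variables (I I' : finType) (f : I' -> I) (n : nat).
Hypothesis f_inj : injective f.
Hypothesis card_I : #|I| = d.+1.
Let D := f @: [set: I'].
Let s := #|~: D|.
Hypothesis D0 : D != set0.
Hypothesis ns : (n <= max_order r s)%N.

Let s_le_d : (s <= d)%N.
Proof. by move: D0 (cardsC D); rewrite -card_gt0 card_I /s; lia. Qed.

Let n_le_k : (n <= k)%N.
Proof. exact: leq_trans ns (max_order_ltk s_le_d). Qed.

Lemma sum_face (al : I -> nat) (J : {set I'}) :
  (\sum_(x in f @: J) al x = \sum_(x in J) al (f x))%N.
Proof. by rewrite big_imset// => x y _ _; exact: f_inj. Qed.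

(** Moving n to the other side turns the bound of [Sigma0] on J into the maximality clause of
    [face_cond]. The truncated subtractions are exact: n is at most [max_order r s], hence at most k
    and at most every [r (s + l)] that occurs. *)
Lemma bubble_index_restrict (al : {ffun I -> 'I_k.+1}) :
  (\sum_(x in ~: D) al x = n)%N ->
  bubble_index (k - n) (fun l => r (s + l) - n)%N [ffun x => al (f x)] =
  (\sum_x al x == k)%N && face_cond (fun x => val (al x)) D.
Proof.
move=> aln; rewrite /bubble_index /face_cond D0 aln ns /=; congr (_ && _).
  have -> : (\sum_x al x = n + \sum_x [ffun x => al (f x)] x)%N.
    rewrite (bigID (mem (~: D))) /= aln; congr (_ + _)%N.
    rewrite (eq_bigl (mem D)) => [|x]; last by rewrite inE negbK.
    by rewrite sum_face; apply: eq_big => x; rewrite ?inE ?ffunE.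
  by apply/eqP/eqP; lia.
have lt_q (J : {set I'}) : J != set0 -> (J \proper [set: I']) ->
    (r (s + #|J|) - n < \sum_(x in J) [ffun x => al (f x)] x)%N =
    (r (s + #|J|) < n + \sum_(x in f @: J) al x)%N.
  move=> J0 JT; rewrite sum_face; under eq_bigr do rewrite ffunE.
  have cJ : (s + #|J| <= d)%N.
    have := cardsC D; rewrite card_I /s /D card_imset//.
    by move: (proper_card JT); lia.
  have : (n <= r (s + #|J|))%N.
    apply: leq_trans ns _; apply: max_order_le; first exact: leq_addr.
    by rewrite cJ andbT; move: J0; rewrite -card_gt0; lia.
  move: (r _) (\sum_(i in J) _)%N => a b; lia.
apply/forallP/forallP => [bJ J|bJ J].
  apply/implyP => JD; apply/implyP => J0; apply/implyP => JD'.
  have JE : J = f @: (f @^-1: J).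
    apply/setP => x; apply/idP/imsetP => [xJ|[x' + ->]]; last by rewrite inE.
    by have /imsetP[x' _ xE] := subsetP JD x xJ; exists x' => //; rewrite inE -xE.
  have PT : f @^-1: J \proper [set: I'].
    by rewrite properT; apply: contraNneq JD' => e; rewrite JE e.
  have P0 : f @^-1: J != set0.
    by apply: contraNneq J0 => e; rewrite JE e imset0.
  have cJ : #|f @^-1: J| = #|J| by rewrite [in RHS]JE card_imset.
  by have := bJ (f @^-1: J); rewrite P0 PT lt_q// -JE cJ.
apply/implyP => J0; apply/implyP => JT; rewrite lt_q//.
have JD : f @: J \subset D by rewrite imsetS ?subsetT.
have J0' : f @: J != set0 by rewrite imset_eq0.
have JD' : f @: J != D.
  apply: contraTneq JT => e; rewrite properT negbK -subTset.
  apply/subsetP => x _; have : f x \in f @: J by rewrite e imset_f.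
  by case/imsetP => y yJ /f_inj ->.
by have := bJ (f @: J); rewrite JD J0' JD' card_imset.
Qed.

Lemma card_face_cond :
  #|[pred al : {ffun I -> 'I_k.+1} | [&& (\sum_x al x == k)%N,
      face_cond (fun x => val (al x)) D & (\sum_(x in ~: D) al x == n)%N]]| =
  (num_multi_index s n * #|@bubble_index I' (k - n) (fun l => r (s + l) - n)%N|)%N.
Proof.
set Y := [pred al | _].
pose h (al : {ffun I -> 'I_k.+1}) : {ffun 'I_s -> 'I_n.+1} * {ffun I' -> 'I_k.+1} :=
  ([ffun j => inord (al (enum_val j))], [ffun x => al (f x)]).
have outside x : x \in ~: D -> exists j : 'I_s, x = enum_val j.
  by move=> xD; exists (enum_rank_in xD x); rewrite enum_rankK_in.
have aln_le (al : {ffun I -> 'I_k.+1}) (j : 'I_s) :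
    (\sum_(x in ~: D) al x = n)%N -> (al (enum_val j) < n.+1)%N.
  by move=> <-; rewrite ltnS (bigD1 (enum_val j)) ?enum_valP//= leq_addr.
(* [inord] loses nothing on [Y], where each exponent outside the face is at most their sum n. *)
have h_inj : {in Y &, injective h}.
  move=> al be /and3P[_ _ /eqP aln] /and3P[_ _ /eqP ben] [] /ffunP e1 /ffunP e2.
  apply/ffunP => x; have [/imsetP[x' _ ->]|xD] := boolP (x \in D).
    by have := e2 x'; rewrite !ffunE.
  have [|j ->] := outside x; first by rewrite inE.
  have := e1 j; rewrite !ffunE => /(congr1 val) /=.
  by rewrite !inordK ?aln_le// => ?; exact: val_inj.
rewrite -(card_in_image h_inj) /num_multi_index -cardX; apply: eq_card => -[th sg].
have sum_th (al : {ffun I -> 'I_k.+1}) : (forall j, val (al (enum_val j)) = th j) ->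
    (\sum_(x in ~: D) al x = \sum_j th j)%N.
  by move=> e; rewrite big_enum_val /=; apply: eq_bigr => j _; rewrite -e.
apply/imageP/idP => [[al alY [-> ->]]|].
  case/and3P: (alY) => aS aD /eqP aln; rewrite inE /= inE; apply/andP; split.
    apply/eqP; apply: etrans (aln); rewrite [RHS]big_enum_val; apply: eq_bigr => j _.
    by rewrite ffunE inordK ?aln_le.
  by rewrite -topredE /= bubble_index_restrict// aS aD.
rewrite inE /= inE => /andP[/eqP thn sgB].
have th_lt j : (th j < k.+1)%N.
  by rewrite ltnS (leq_trans _ n_le_k)// -ltnS ltn_ord.
(* Outside the face the sum has exactly one term, the j with [enum_val j == x]; it serves as an
   inverse of [enum_val]. *)
pose al : {ffun I -> 'I_k.+1} := [ffun x => if [pick x' | f x' == x] is Some x'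
  then sg x' else inord (\sum_(j < s | enum_val j == x) th j)].
have alf x : al (f x) = sg x.
  by rewrite ffunE; case: pickP => [x' /eqP/f_inj -> //|/(_ x)]; rewrite eqxx.
have alo j : val (al (enum_val j)) = th j.
  rewrite ffunE; case: pickP => [x' /eqP e|_].
    by have := enum_valP j; rewrite inE -e imset_f.
  rewrite (big_pred1 j) => [|j'];  last by rewrite (inj_eq enum_val_inj).
  by rewrite /= inordK.
have aln : (\sum_(x in ~: D) al x = n)%N by rewrite sum_th.
have hal : [ffun x => al (f x)] = sg by apply/ffunP => x; rewrite ffunE alf.
exists al; last first.
  congr pair => //; apply/ffunP => j; apply/val_inj.
  rewrite [X in _ = \val X]ffunE /= inordK alo//.
by have := bubble_index_restrict aln; rewrite hal [LHS]sgB inE aln eqxx andbT.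
Qed.

End face_count.

Lemma card_sum (T : finType) (P : pred T) : #|P| = (\sum_x P x)%N.
Proof. 
by rewrite -sum1_card big_mkcond; apply: eq_bigr => x _; rewrite unfold_in; case: (P x).
Qed.

(** Double count: a multi-index of total k belongs to exactly one face, and then to exactly one
    order n, its sum outside that face, which [face_cond] keeps in range. *)
Lemma card_face_cond_total (I : finType) : #|I| = d.+1 ->
  (\sum_(D : {set I} | D != set0) \sum_(n < (max_order r #|~: D|).+1)
    #|[pred al : {ffun I -> 'I_k.+1} | [&& (\sum_x al x == k)%N,
      face_cond (fun x => val (al x)) D & (\sum_(x in ~: D) al x == n)%N]]| =
  #|[pred al : {ffun I -> 'I_k.+1} | \sum_x al x == k]|)%N.
Proof.
move=> card_I; rewrite -[RHS]sum1_card.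
transitivity (\sum_(al : {ffun I -> 'I_k.+1} | (\sum_x al x == k)%N)
  \sum_(D : {set I}) face_cond (fun x => val (al x)) D)%N; last first.
  apply: eq_bigr => al /eqP alk.
  have [D cD] := face_cond_exists (fun x => val (al x)) card_I.
  rewrite (bigD1 D)//= cD big1// => D' /eqP DD'.
  by apply/eqP; rewrite eqb0; apply/negP => cD'; apply: DD'; exact: face_cond_uniq cD' cD.
rewrite exchange_big [RHS](bigID (fun D : {set I} => D != set0)) /=
  [X in _ = (_ + X)%N]big1; last first.
  move=> D; rewrite negbK => /eqP ->.
  by rewrite big1// => al _; rewrite /face_cond eqxx.
rewrite addn0; apply: eq_bigr => D D0.
rewrite (eq_bigr _ (fun n _ => card_sum _)).
rewrite exchange_big [RHS]big_mkcond; apply: eq_bigr => al _ /=.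
case: ifPn => [alk|nk]; last by rewrite big1.
case cD: (face_cond _ D) => /=; last by rewrite big1.
have /and3P[_ le _] := cD.
rewrite (bigD1 (Ordinal (le : _ < _.+1)))//= eqxx big1// => n.
by rewrite -val_eqE /= eq_sym => /negbTE ->.
Qed.

End orders.

From mathcomp Require Import all_classical all_reals all_analysis.
From mathcomp Require Import measurable_realfun.
From mathcomp Require Import ring.

Import Order.TTheory GRing.Theory Num.Theory.
Import numFieldNormedType.Exports.

Local Open Scope classical_set_scope.
Local Open Scope ring_scope.

(** * Polynomial functions *)

Section polyfun.
Context {R : realType} {m : nat}.
Implicit Types (a : {ffun 'I_m -> nat}) (f g : 'rV[R]_m -> R) (rho : rel nat).

Definition mono a (x : 'rV[R]_m) : R := \prod_i x 0 i ^+ a i.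

Definition mdeg a : nat := (\sum_i a i)%N.

(* [rho n] constrains the degrees of the monomials: [eq_op] stands for the
   homogeneous polynomials of degree [n], [geq] for those of degree at most [n]
   and [leq] for those vanishing to order [n] at the origin. *)
Definition polyfun rho (n : nat) f : Prop :=
  exists (I : finType) (c : I -> R) (a : I -> {ffun 'I_m -> nat}),
    (forall i, rho n (mdeg (a i))) /\ f = fun x => \sum_i c i * mono (a i) x.

Lemma polyfun_mono rho n a : rho n (mdeg a) -> polyfun rho n (mono a).
Proof.
move=> na; exists unit, (fun=> 1), (fun=> a); split=> // .
by apply/funext => x; rewrite big_const card_unit /= addr0 mul1r.
Qed.

Lemma eq_polyfun rho n f g : f =1 g -> polyfun rho n f -> polyfun rho n g.
Proof. by move=> /funext ->. Qed.

Lemma polyfun0 rho n : polyfun rho n (fun=> 0).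
Proof.
exists void, (fun=> 1), (fun=> [ffun=> 0%N]); split => [[]|].
by apply/funext => x; rewrite big1// => -[].
Qed.

Lemma polyfunD rho n f g :
  polyfun rho n f -> polyfun rho n g -> polyfun rho n (fun x => f x + g x).
Proof.
move=> [I [c [a [ca ->]]]] [J [c' [a' [ca' ->]]]].
exists (I + J)%type, (fun i => match i with inl i => c i | inr j => c' j end),
  (fun i => match i with inl i => a i | inr j => a' j end).
by split=> [[]//|]; apply/funext => x; rewrite big_sumType.
Qed.

Lemma polyfunZ rho n b f : polyfun rho n f -> polyfun rho n (fun x => b * f x).
Proof.
move=> [I [c [a [ca ->]]]]; exists I, (fun i => b * c i), a; split=> //.
by apply/funext => x; rewrite mulr_sumr; apply: eq_bigr => i _; rewrite mulrA.
Qed.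

Lemma polyfunB rho n f g :
  polyfun rho n f -> polyfun rho n g -> polyfun rho n (fun x => f x - g x).
Proof.
move=> pf /(polyfunZ (-1)) pg; have := polyfunD pf pg.
by congr polyfun; apply/funext => x; rewrite mulN1r.
Qed.

Lemma monoD a a' x :
  mono [ffun i => (a i + a' i)%N] x = mono a x * mono a' x.
Proof.
by rewrite /mono -big_split; apply: eq_bigr => i _; rewrite ffunE exprD.
Qed.

Lemma polyfunM rho rho' rho'' n n' n'' f g :
  (forall d d', rho n d -> rho' n' d' -> rho'' n'' (d + d')%N) ->
  polyfun rho n f -> polyfun rho' n' g -> polyfun rho'' n'' (fun x => f x * g x).
Proof.
move=> rhoD [I [c [a [ca ->]]]] [J [c' [a' [ca' ->]]]].
exists (I * J)%type, (fun ij => c ij.1 * c' ij.2),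
  (fun ij => [ffun i => (a ij.1 i + a' ij.2 i)%N]); split=> [[i j]|].
  have -> : mdeg [ffun l => (a i l + a' j l)%N] = (mdeg (a i) + mdeg (a' j))%N.
    by rewrite /mdeg -big_split; apply: eq_bigr => l _; rewrite ffunE.
  exact: rhoD.
apply/funext => x; rewrite mulr_suml.
under eq_bigr do rewrite mulr_sumr.
rewrite pair_big; apply: eq_bigr => -[i j] _ /=.
by rewrite monoD mulrACA.
Qed.

Lemma polyfun_sum rho n (I : Type) (r : seq I) (P : pred I)
    (F : I -> 'rV[R]_m -> R) : (forall i, P i -> polyfun rho n (F i)) ->
  polyfun rho n (fun x => \sum_(i <- r | P i) F i x).
Proof.
move=> pF; elim: r => [|i r IH].
  by under eq_fun do rewrite big_nil; exact: polyfun0.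
under eq_fun do rewrite big_cons; case Pi: (P i) => //; move: (pF _ Pi) => {}Pi.
exact: polyfunD.
Qed.

Lemma mdeg0 : mdeg [ffun=> 0%N] = 0%N.
Proof. by rewrite /mdeg big1// => i _; rewrite ffunE. Qed.

Lemma mono0 x : mono [ffun=> 0%N] x = 1.
Proof. by rewrite /mono big1// => i _; rewrite ffunE expr0. Qed.

Lemma polyfun_cst rho b : rho 0 0%N -> polyfun rho 0 (fun=> b).
Proof.
move=> rho00; have -> : (fun=> b) = (fun x => b * mono [ffun=> 0%N] x).
  by apply/funext => x; rewrite mono0 mulr1.
by apply: polyfunZ; apply: polyfun_mono; rewrite mdeg0.
Qed.

Definition additive_rel rho :=
  rho 0 0%N /\ forall n n' d d', rho n d -> rho n' d' -> rho (n + n') (d + d')%N.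

Lemma additive_eq : additive_rel eq_op.
Proof. by split=> // n n' d d' /eqP -> /eqP ->. Qed.

Lemma additive_leq : additive_rel leq.
Proof. by split=> // *; exact: leq_add. Qed.

Lemma additive_geq : additive_rel geq.
Proof. by split=> // *; exact: leq_add. Qed.

Lemma polyfunX rho n b f : additive_rel rho -> polyfun rho n f ->
  polyfun rho (b * n) (fun x => f x ^+ b).
Proof.
move=> [rho0 rhoD] pf; elim: b => [|b IH].
  by under eq_fun do rewrite expr0; exact: polyfun_cst.
under eq_fun do rewrite exprS; apply: (polyfunM _ pf IH).
by move=> d d' *; rewrite mulSn; exact: rhoD.
Qed.

Lemma polyfun_prod rho (I : Type) (r : seq I) (P : pred I) (n : I -> nat)
    (F : I -> 'rV[R]_m -> R) : additive_rel rho ->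
  (forall i, P i -> polyfun rho (n i) (F i)) ->
  polyfun rho (\sum_(i <- r | P i) n i)%N (fun x => \prod_(i <- r | P i) F i x).
Proof.
move=> [rho0 rhoD] pF; elim: r => [|i r IH].
  rewrite big_nil; apply: (eq_polyfun (f := fun=> 1)); last exact: polyfun_cst.
  by move=> x; rewrite big_nil.
rewrite big_cons; case Pi: (P i).
  apply: (eq_polyfun (f := fun x => F i x * \prod_(j <- r | P j) F j x)).
    by move=> x; rewrite big_cons Pi.
  by apply: (polyfunM _ (pF _ Pi) IH) => *; exact: rhoD.
by apply: eq_polyfun IH => x; rewrite big_cons Pi.
Qed.

Lemma polyfun_weaken rho rho' n n' f : (forall d, rho n d -> rho' n' d) ->
  polyfun rho n f -> polyfun rho' n' f.
Proof.
by move=> rr [I [c [a [ca ->]]]]; exists I, c, a; split=> // i; exact/rr/ca.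
Qed.

Lemma polyfun_coord rho i : rho 1 1%N -> polyfun rho 1 (fun x => x 0 i).
Proof.
move=> rho1.
have -> : (fun x : 'rV[R]_m => x 0 i) = mono [ffun j => nat_of_bool (j == i)].
  apply/funext => x; rewrite /mono (bigD1 i)//= big1 ?mulr1 ?ffunE ?eqxx//.
  by move=> j ji; rewrite ffunE (negbTE ji).
apply: polyfun_mono.
suff -> : mdeg [ffun j => nat_of_bool (j == i)] = 1%N by [].
rewrite /mdeg (bigD1 i)//= big1 ?addn0 ?ffunE ?eqxx//.
by move=> j ji; rewrite ffunE (negbTE ji).
Qed.

Lemma polyfun_linear rho (b : 'I_m -> R) : rho 1 1%N ->
  polyfun rho 1 (fun x => \sum_i x 0 i * b i).
Proof.
move=> rho1; apply: polyfun_sum => i _; under eq_fun do rewrite mulrC.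
by apply: polyfunZ; exact: polyfun_coord.
Qed.

(** Constant monomials cancel and all others have positive degree. The order gained here makes the
    remainder of [bern_split] invisible to the derivatives in question. *)
Lemma polyfun_sub0 f : polyfun leq 0 f -> polyfun leq 1 (fun x => f x - f 0).
Proof.
move=> [I [c [a [_ ->]]]].
have -> : (fun x : 'rV[R]_m =>
    \sum_i c i * mono (a i) x - \sum_i c i * mono (a i) 0) =
    (fun x => \sum_i c i * (mono (a i) x - mono (a i) 0)).
  by apply/funext => x; rewrite -sumrB; apply: eq_bigr => i _; rewrite mulrBr.
apply: polyfun_sum => i _; apply: polyfunZ.
have [/eqP d0|d0] := boolP (mdeg (a i) == 0%N).
  have -> : a i = [ffun=> 0%N].
    move/eqP: d0; rewrite sum_nat_eq0 => /forallP d0.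
    by apply/ffunP => j; rewrite ffunE; apply/eqP/(implyP (d0 j)).
  under eq_fun do rewrite !mono0 subrr.
  exact: polyfun0.
have [j aj] : exists j, a i j != 0%N.
  apply/existsP; apply: contraR d0; rewrite negb_exists => /forallP d0.
  by rewrite sum_nat_eq0; apply/forallP => j; apply/implyP => _; move: (d0 j); rewrite negbK.
have -> : mono (a i) 0 = 0.
  by rewrite /mono (bigD1 j)//= mxE expr0n (negbTE aj) mul0r.
under eq_fun do rewrite subr0.
by apply: polyfun_mono; rewrite lt0n.
Qed.

End polyfun.

(** * Derivatives of polynomial functions and Taylor coefficients at the origin *)

Section derivatives.
Context {R : realType}.

(** The difference quotients coincide, even across different spaces. This reduces partial
    derivatives to one variable, normal derivatives to fibre coordinates, and absorbs
    translations. *)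
Lemma derive_transfer (V V' W : normedModType R) (f : V -> W) (f' : V' -> W)
    v v' x x' : (forall h : R, f (h *: v + x) = f' (h *: v' + x')) ->
  'D_v f x = 'D_v' f' x' /\ (derivable f' x' v' -> derivable f x v).
Proof.
move=> ff'; have e : f x = f' x' by have := ff' 0; rewrite !scale0r !add0r.
have E : (fun h : R => h^-1 *: ((f \o shift x) (h *: v) - f x)) =
    (fun h => h^-1 *: ((f' \o shift x') (h *: v') - f' x')).
  by apply/funext => h /=; rewrite /shift ff' e.
by rewrite /derive /derivable E.
Qed.

Lemma is_derive_bigsum (V : normedModType R) (I : Type) (s : seq I)
    (h : I -> V -> R) (dh : I -> R) x v :
  (forall i, is_derive x v (h i) (dh i)) ->
  is_derive x v (fun y => \sum_(i <- s) h i y) (\sum_(i <- s) dh i).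
Proof.
move=> hd; elim: s => [|i s IH].
  rewrite big_nil; rewrite (_ : (fun y => _) = cst 0); first exact: is_derive_cst.
  by apply/funext => y; rewrite big_nil.
rewrite big_cons (_ : (fun y => _) = h i + (fun y => \sum_(i <- s) h i y)).
  exact: is_deriveD.
by apply/funext => y; rewrite big_cons.
Qed.

Section mono.
Context {m : nat}.
Implicit Types (a theta : {ffun 'I_m -> nat}).

Lemma is_derive_mono a j (x : 'rV[R]_m) :
  is_derive x (delta_mx 0 j) (mono a)
    ((a j)%:R * mono [ffun i => (a i - (i == j))%N] x).
Proof.
pose C := \prod_(i | i != j) x 0 i ^+ a i.
have monoE (h : R) : mono a (h *: delta_mx 0 j + x) =
    ((fun s : R => s ^+ a j * C) : R -> R) (h *: (1 : R) + x 0 j).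
  rewrite /mono (bigD1 j)//= !mxE !eqxx; congr (_ * _).
  by apply: eq_bigr => i ij; rewrite !mxE eqxx (negbTE ij) mulr0 add0r.
have [De Dd] := @derive_transfer _ R R (mono a)
  (fun s : R => s ^+ a j * C) (delta_mx 0 j) 1 x (x 0 j) monoE.
have dX : is_derive (x 0 j) 1 (fun s : R => s ^+ a j * C)
    (C * ((a j)%:R * x 0 j ^+ (a j).-1)).
  rewrite (_ : (fun s => _) = C \*o (fun s : R => s ^+ a j)); last first.
    by apply/funext => s /=; rewrite mulrC.
  have dX := @exprn_derivable R (a j) (x 0 j) 1.
  apply: DeriveDef; first exact: derivableZ.
  have -> : 'D_1 (C \*o (fun s : R => s ^+ a j)) (x 0 j) =
      C *: 'D_1 (fun s : R => s ^+ a j) (x 0 j).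
    exact: deriveZ.
  by rewrite exp_derive /GRing.scale /= mulr1.
apply: DeriveDef; first by apply: Dd; apply: ex_derive.
rewrite De derive_val mulrCA; congr (_ * _).
rewrite /mono (bigD1 j)//= ffunE eqxx subn1 mulrC; congr (_ * _).
by apply: eq_bigr => i ij; rewrite ffunE (negbTE ij) subn0.
Qed.

Lemma derive_mono_sum (I : finType) (c : I -> R) (a : I -> {ffun 'I_m -> nat}) j :
  'D_(delta_mx 0 j) (fun x => \sum_i c i * mono (a i) x) =
  fun x => \sum_i c i * (a i j)%:R * mono [ffun l => (a i l - (l == j))%N] x.
Proof.
apply/funext => x; have := fun i => is_derive_mono (a i) j x.
move=> da; have dca i : is_derive x (delta_mx 0 j) (c i \*o mono (a i))
    (c i * (a i j)%:R * mono [ffun l => (a i l - (l == j))%N] x).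
  by rewrite -mulrA; exact: is_deriveZ.
by have dS := is_derive_bigsum (index_enum I) dca; rewrite derive_val.
Qed.

Lemma iter_derive_mono_sum (I : finType) (c : I -> R)
    (a : I -> {ffun 'I_m -> nat}) j b :
  iter b (fun g => 'D_(delta_mx 0 j) g) (fun x => \sum_i c i * mono (a i) x) =
  fun x => \sum_i c i * (a i j ^_ b)%:R *
    mono [ffun l => (a i l - (if l == j then b else 0))%N] x.
Proof.
elim: b => [|b IH] /=.
  apply/funext => x; apply: eq_bigr => i _; rewrite ffactn0 mulr1.
  by congr (_ * mono _ _); apply/ffunP => l; rewrite ffunE if_same subn0.
rewrite IH derive_mono_sum; apply/funext => x; apply: eq_bigr => i _.
rewrite ffunE eqxx ffactnSr natrM mulrA; congr (_ * mono _ _).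
apply/ffunP => l; rewrite !ffunE.
by case: (l == j); rewrite ?subn0// -subnDA addn1.
Qed.

(** Truncated subtraction in the exponents is harmless: where [theta] exceeds an exponent, the
    falling factorial [^_] is zero. *)
Lemma normal_derive_mono_sum (theta : 'I_m -> nat) (I : finType) (c : I -> R)
    (a : I -> {ffun 'I_m -> nat}) :
  normal_derive 1%:M theta (fun x => \sum_i c i * mono (a i) x) =
  fun x => \sum_i c i * (\prod_j (a i j ^_ theta j))%:R *
    mono [ffun l => (a i l - theta l)%N] x.
Proof.
rewrite /normal_derive.
(* The list must be free of duplicates so that a coordinate still carries its full exponent when its
   turn comes. *)
suff H (s : seq 'I_m) : uniq s -> foldr (fun j f => iter (theta j)
      (fun g => 'D_(row j 1%:M) g) f) (fun x : 'rV[R]_m => \sum_i c i * mono (a i) x) s =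
    fun x => \sum_i c i * (\prod_(j <- s) (a i j ^_ theta j))%:R *
      mono [ffun l => (a i l - (if l \in s then theta l else 0))%N] x.
  rewrite H ?enum_uniq//; apply/funext => x; apply: eq_bigr => i _.
  rewrite big_enum; congr (_ * mono _ _).
  by apply/ffunP => l; rewrite !ffunE mem_enum.
elim: s => [_|j s IH /andP[js us]] /=.
  apply/funext => x; apply: eq_bigr => i _; rewrite big_nil mulr1.
  by congr (_ * mono _ _); apply/ffunP => l; rewrite ffunE subn0.
rewrite IH// row1 iter_derive_mono_sum; apply/funext => x; apply: eq_bigr => i _.
rewrite ffunE (negbTE js) subn0 big_cons natrM -!mulrA; congr (_ * _).
rewrite mulrCA; congr (_ * (_ * mono _ _)).
apply/ffunP => l; rewrite !ffunE in_cons; case: eqVneq => [->|] /=.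
  by rewrite (negbTE js) subn0.
by rewrite subn0.
Qed.

Lemma mono_at0 a : mono a (0 : 'rV[R]_m) = (mdeg a == 0%N)%:R.
Proof.
rewrite /mono /mdeg; have [/eqP|] := boolP (_ == _).
  move/eqP; rewrite sum_nat_eq0 => /forallP a0.
  by rewrite big1// => i _; rewrite mxE (eqP (implyP (a0 i) _)).
rewrite sum_nat_eq0 negb_forall => /existsP[i]; rewrite implyTb => ai.
by rewrite (bigD1 i)//= mxE expr0n (negbTE ai) mul0r.
Qed.

Lemma polyfun_at0 n (f : 'rV[R]_m -> R) : polyfun leq n.+1 f -> f 0 = 0.
Proof.
move=> [I [c [a [a1 ->]]]]; rewrite big1// => j _.
rewrite mono_at0 (_ : _ == _ = false) ?mulr0//.
by apply/negbTE; rewrite -lt0n (leq_trans _ (a1 j)).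
Qed.

(** Taylor coefficient: an exponent below [theta] somewhere is killed by the falling factorial, any
    other one different from [theta] by evaluation at 0. *)
Lemma normal_derive_at0 (theta : 'I_m -> nat) (I : finType) (c : I -> R)
    (a : I -> {ffun 'I_m -> nat}) :
  normal_derive 1%:M theta (fun x => \sum_i c i * mono (a i) x) 0 =
  (\prod_j (theta j)`!)%:R * \sum_(i | a i == finfun theta) c i.
Proof.
rewrite normal_derive_mono_sum mulr_sumr [RHS]big_mkcond; apply: eq_bigr => i _.
rewrite mono_at0; have [ai|ai] := eqVneq (a i) (finfun theta).
  have -> : mdeg [ffun l => (a i l - theta l)%N] = 0%N.
    by rewrite /mdeg big1// => l _; rewrite ffunE ai ffunE subnn.
  rewrite mulr1 mulrC; congr (_ %:R * _).
  by apply: eq_bigr => j _; rewrite ai ffunE ffactnn.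
have [|] := boolP (mdeg _ == 0%N); last by rewrite mulr0.
rewrite sum_nat_eq0 => /forallP le; rewrite mulr1.
have [j lt] : exists j, (a i j < theta j)%N.
  apply/existsP; apply: contraR ai; rewrite negb_exists => /forallP ge.
  apply/eqP/ffunP => j; rewrite ffunE; apply/eqP.
  move: (ge j) (le j); rewrite -leqNgt ffunE implyTb subn_eq0 eqn_leq => -> ->.
  by [].
by rewrite (bigD1 j)//= ffact_small// mul0n mulr0.
Qed.

Lemma polyfun_normal_derive0 n (theta : 'I_m -> nat) (f : 'rV[R]_m -> R) :
  polyfun leq n f -> (\sum_j theta j < n)%N -> normal_derive 1%:M theta f 0 = 0.
Proof.
move=> [I [c [a [na ->]]]] lt; rewrite normal_derive_at0 [X in _ * X]big_pred0 ?mulr0// => i.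
apply: contraTF (na i) => /eqP ->; rewrite -ltnNge; apply: leq_trans lt.
by rewrite ltnS leq_eqVlt; apply/orP; left; apply/eqP/eq_bigr => j _; rewrite ffunE.
Qed.

Lemma polyfun_normal_derive_eq0 n (f : 'rV[R]_m -> R) : polyfun eq_op n f ->
  (forall theta : 'I_m -> nat, (\sum_j theta j = n)%N ->
     normal_derive 1%:M theta f 0 = 0) -> forall x, f x = 0.
Proof.
move=> [I [c [a [na ->]]]] D0 x.
have le i (j : 'I_m) : (a i j < n.+1)%N.
  by rewrite ltnS (eqP (na i)) /mdeg (bigD1 j)//= leq_addr.
(* A [polyfun] may list a monomial several times, so only sums of coefficients over equal exponents
   are known to vanish; [key] groups them. *)
pose key i : {ffun 'I_m -> 'I_n.+1} := [ffun j => inord (a i j)].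
have keyE i b : (key i == b) = (a i == [ffun j => val (b j)]).
  apply/eqP/eqP => [<-|ab]; apply/ffunP => j.
    by rewrite /key !ffunE /= inordK.
  by apply: val_inj; rewrite /key ffunE ab ffunE /= inordK.
rewrite (partition_big key xpredT)//= big1// => b _.
under eq_bigl do rewrite keyE.
rewrite (eq_bigr (fun i => c i * mono [ffun j => val (b j)] x)); last first.
  by move=> i /eqP ->.
rewrite -mulr_suml.
have [bn|bn] := eqVneq (\sum_j b j)%N n; last first.
  rewrite big_pred0 ?mul0r// => i; apply: contraNF bn => /eqP ab.
  have /eqP nE := na i; apply/eqP/esym/(etrans nE); rewrite ab /mdeg.
  by apply: eq_bigr => j _; rewrite ffunE.
have /eqP := D0 (fun j => val (b j)) bn.
rewrite normal_derive_at0 mulf_eq0 pnatr_eq0 => /orP[|/eqP].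
  rewrite -[_ == _]negbK -lt0n prodn_gt0// => j; exact: fact_gt0.
have -> : [ffun j => val (b j)] = finfun (fun j => val (b j)) by [].
by move=> ->; rewrite mul0r.
Qed.

End mono.

(* Both sides are limits of the same difference quotients, so [u] need not be
   derivable. *)
Lemma normal_derive_frame s d (N : 'M[R]_(s, d)) (theta : 'I_s -> nat) u y t :
  normal_derive N theta u (y + t *m N) =
  normal_derive 1%:M theta (fun t => u (y + t *m N)) t.
Proof.
rewrite /normal_derive; elim: (enum 'I_s) t => [//|j l IH] t /=.
elim: (theta j) t => [//|b IHb] t /=.
apply: (derive_transfer _).1 => h.
have -> : h *: row j N + (y + t *m N) = y + (h *: row j 1%:M + t) *m N.
  by rewrite mulmxDl -scalemxAl row1 -rowE addrCA.
exact: IHb.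
Qed.

Lemma polyfun_derive m n (f : 'rV[R]_m -> R) j : polyfun leq n f ->
  polyfun leq n.-1 ('D_(delta_mx 0 j) f).
Proof.
move=> [I [c [a [na ->]]]]; rewrite derive_mono_sum; apply: polyfun_sum => i _.
apply: polyfunZ; apply: polyfun_mono; move: (na i); rewrite /mdeg (bigD1 j)//= => le.
rewrite (bigD1 j)//= ffunE eqxx -subn1 leq_subLR addnA.
rewrite [X in (_ <= _ + X)%N](eq_bigr (a i)); last first.
  by move=> l lj; rewrite ffunE (negbTE lj) subn0.
by apply: leq_trans le _; rewrite leq_add2r -leq_subLR.
Qed.

Lemma differentiable_polyfun m rho n (f : 'rV[R]_m -> R) x :
  polyfun rho n f -> differentiable f x.
Proof.
have dX (e : nat) j : differentiable (fun y : 'rV[R]_m => y 0 j ^+ e) x.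
  elim: e => [|e IH]; first by rewrite (_ : (fun y => _) = cst 1)//; exact: differentiable_cst.
  rewrite (_ : (fun y : 'rV[R]_m => y 0 j ^+ e.+1) =
    (fun y : 'rV[R]_m => y 0 j : R) * (fun y : 'rV[R]_m => y 0 j ^+ e)).
    by apply: differentiableM => //; exact: differentiable_coord.
  by apply/funext => y; rewrite exprS.
have dm a : differentiable (@mono R m a) x.
  rewrite /mono; elim: (index_enum _) => [|j l IH].
    rewrite (_ : (fun y => _) = cst 1); first exact: differentiable_cst.
    by apply/funext => y; rewrite big_nil.
  rewrite (_ : (fun y => _) = (fun y : 'rV[R]_m => y 0 j ^+ a j) *
      (fun y : 'rV[R]_m => \prod_(i <- l) y 0 i ^+ a i)).
    by apply: differentiableM.
  by apply/funext => y; rewrite big_cons.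
move=> [I [c [a [_ ->]]]].
elim: (index_enum _) => [|j l IH].
  rewrite (_ : (fun y => _) = cst 0); first exact: differentiable_cst.
  by apply/funext => y; rewrite big_nil.
rewrite (_ : (fun y => _) = c j *: @mono R m (a j) +
    (fun y => \sum_(i <- l) c i * mono (a i) y)).
  by apply: differentiableD => //; exact: differentiableZ.
by apply/funext => y; rewrite big_cons.
Qed.

Lemma continuous_polyfun m rho n (f : 'rV[R]_m -> R) :
  polyfun rho n f -> continuous f.
Proof. by move=> pf x; apply/differentiable_continuous/differentiable_polyfun/pf. Qed.

Lemma polyfun_derive_dir m (f : 'rV[R]_m -> R) v : polyfun leq 0 f ->
  polyfun leq 0 ('D_v f).
Proof.
move=> pf; have -> : 'D_v f = (fun x => \sum_j v 0 j * 'D_(delta_mx 0 j) f x).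
  apply/funext => x; have df := differentiable_polyfun x pf.
  rewrite deriveE// {1}[v]row_sum_delta linear_sum; apply: eq_bigr => j _.
  by rewrite linearZ deriveE.
by apply: polyfun_sum => j _; apply: polyfunZ; exact: polyfun_derive pf.
Qed.

Lemma normal_derive_polyfun_closed m s (N : 'M[R]_(s, m)) theta (f g : 'rV[R]_m -> R) :
  polyfun leq 0 f -> polyfun leq 0 g ->
  polyfun leq 0 (normal_derive N theta f) /\
  normal_derive N theta (fun y => f y - g y) =
  (fun y => normal_derive N theta f y - normal_derive N theta g y).
Proof.
move=> pf pg.
suff H l : let D f := foldr (fun j f => iter (theta j) (fun g => 'D_(row j N) g) f) f l in
    [/\ polyfun leq 0 (D f), polyfun leq 0 (D g) &
      D (fun y => f y - g y) = (fun y => D f y - D g y)].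
  by have [] := H (enum 'I_s).
elim: l => [|j l [Df Dg DB]] /=; first by split.
rewrite DB; elim: (theta j) => [|b [IHf IHg IHB]] /=; first by split.
split; [exact: polyfun_derive_dir|exact: polyfun_derive_dir|].
rewrite IHB; apply/funext => y.
by apply: deriveB; apply: diff_derivable; apply: differentiable_polyfun; eassumption.
Qed.

End derivatives.

(** * Linear independence of monomials on positive arguments *)

Section independence.

Lemma digits_inj B n (a b : nat -> nat) :
  (forall i, (a i < B)%N) -> (forall i, (b i < B)%N) ->
  (\sum_(i < n) a i * B ^ i = \sum_(i < n) b i * B ^ i)%N ->
  forall i, (i < n)%N -> a i = b i.
Proof.
elim: n a b => [//|n IH] a b aB bB.
have B0 : (0 < B)%N by exact: leq_ltn_trans (aB 0%N).
have shift (c : nat -> nat) : (\sum_(i < n.+1) c i * B ^ i =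
    (\sum_(i < n) c i.+1 * B ^ i) * B + c 0)%N.
  rewrite big_ord_recl expn0 muln1 addnC big_distrl; congr (_ + _)%N.
  by apply: eq_bigr => i _ /=; rewrite expnSr mulnA.
rewrite !shift => e.
have e0 : a 0%N = b 0%N.
  by have := congr1 (modn^~ B) e; rewrite /= !modnMDl !modn_small.
move: e; rewrite e0 => /addIn/eqP; rewrite eqn_mul2r gtn_eqF//= => /eqP e.
by case=> [//|i]; rewrite ltnS; apply: (IH (a \o succn) (b \o succn)) e i => j /=.
Qed.

(* Kronecker substitution: [l i = t ^ (k + 1) ^ (rank of i)] separates all the
   multi-indices, so the form becomes a univariate polynomial in [t]. *)
Lemma positive_monomials_free {R : realType} (I : finType) k
    (c : {ffun I -> 'I_k.+1} -> R) :
  (forall l : I -> R, (forall i, 0 < l i) ->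
     \sum_al c al * \prod_i l i ^+ al i = 0) -> forall al, c al = 0.
Proof.
move=> c0; pose w (i : I) := (k.+1 ^ enum_rank i)%N.
pose e (al : {ffun I -> 'I_k.+1}) := (\sum_i al i * w i)%N.
have e_inj : injective e.
  move=> al be; rewrite /e.
  pose dig (g : {ffun I -> 'I_k.+1}) (j : nat) :=
    if (insub j : option 'I_#|I|) is Some j' then val (g (enum_val j')) else 0%N.
  have dig_lt g j : (dig g j < k.+1)%N.
    by rewrite /dig; case: insub => [j'|//]; exact: ltn_ord.
  have digE (g : {ffun I -> 'I_k.+1}) : (\sum_i g i * w i = \sum_(j < #|I|) dig g j * k.+1 ^ j)%N.
    rewrite (reindex (@enum_val I I)) /=; last exact: onW_bij (enum_val_bij I).
    by apply: eq_bigr => j _; rewrite /w /dig enum_valK valK.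
  rewrite !digE => /digits_inj H; apply/ffunP => i; apply/val_inj.
  have := H (dig_lt al) (dig_lt be) _ (ltn_ord (enum_rank i)).
  by rewrite /dig valK enum_rankK.
pose p : {poly R} := \sum_al c al *: 'X^(e al).
have p0 : p = 0.
  have [//|p0] := eqVneq p 0.
  (* [size p] distinct positive roots, one more than the degree allows. *)
  pose rs := [seq (i.+1%:R : R) | i <- iota 0 (size p)].
  suff /(max_poly_roots p0) : all (root p) rs.
    rewrite size_map size_iota ltnn map_inj_uniq ?iota_uniq => [/(_ isT)//|].
    by move=> i j /eqP; rewrite eqr_nat => /eqP[].
  apply/allP => _ /mapP[i _ ->]; rewrite /root horner_sum.
  apply/eqP; rewrite -[RHS](c0 (fun j => i.+1%:R ^+ w j)); last first.
    by move=> j; rewrite exprn_gt0// ltr0n.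
  apply: eq_bigr => al _; rewrite hornerZ hornerXn /e; congr (_ * _).
  rewrite expr_sum; apply: eq_bigr => j _; by rewrite -exprM mulnC.
move=> al; have := congr1 (fun q : {poly R} => q`_(e al)) p0.
rewrite coef0 coef_sum (bigD1 al)//= coefZ coefXn eqxx mulr1 big1 ?addr0//.
move=> be ab; rewrite coefZ coefXn (inj_eq e_inj) eq_sym (negbTE ab).
by rewrite mulr0.
Qed.
End independence.

(** * Spans and dimensions *)

Section spans.
Context {R : realType} {V : lmodType R}.
Implicit Types (S U : set V).

Lemma lspan_sum S (I : finType) (c : I -> R) (e : I -> V) :
  (forall i, S (e i)) -> lspan S (\sum_i c i *: e i).
Proof.
move=> Se; exists #|I|, (c \o enum_val), (e \o enum_val); split=> [i|].
  exact: Se.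
by rewrite (reindex (@enum_val I I)) //; exact: onW_bij (enum_val_bij I).
Qed.

Lemma lspan_bigsum S (I : finType) (P : pred I) (c : I -> R) (e : I -> V) :
  (forall i, P i -> S (e i)) -> lspan S (\sum_(i | P i) c i *: e i).
Proof.
move=> Se; rewrite (eq_bigl (fun i => i \in P))// big_enum_val /=.
by apply: lspan_sum => i; apply: Se; have := enum_valP i.
Qed.

Lemma lspan0 S : lspan S 0.
Proof. by exists 0%N, (fun=> 0), (fun=> 0); rewrite big_ord0; split=> // -[]. Qed.

Lemma lspanD S v w : lspan S v -> lspan S w -> lspan S (v + w).
Proof.
move=> [n [c [e [Se ->]]]] [m [c' [e' [Se' ->]]]].
have := @lspan_sum S ('I_n + 'I_m)%type
  (fun i => match i with inl i => c i | inr j => c' j end)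
  (fun i => match i with inl i => e i | inr j => e' j end).
by rewrite big_sumType; apply => -[].
Qed.

Lemma lspanZ S b v : lspan S v -> lspan S (b *: v).
Proof.
move=> [n [c [e [Se ->]]]]; rewrite scaler_sumr.
by under eq_bigr do rewrite scalerA; apply: lspan_sum.
Qed.

Lemma sub_lspan S : S `<=` lspan S.
Proof. by move=> x Sx; exists 1%N, (fun=> 1), (fun=> x); rewrite big_ord1 scale1r. Qed.

Lemma lspan_sub S S' : S `<=` lspan S' -> lspan S `<=` lspan S'.
Proof.
move=> SS' _ [n [c [e [Se ->]]]]; apply: big_ind.
- exact: lspan0.
- by move=> *; exact: lspanD.
- by move=> i _; apply/lspanZ/SS'.
Qed.

Lemma lspan_range (I : finType) (e : I -> V) v :
  lspan (range e) v -> exists c : I -> R, v = \sum_i c i *: e i.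
Proof.
move=> [n [c [f [ef ->]]]].
have [g gE] : exists g : 'I_n -> I, forall i, e (g i) = f i.
  have /choice[g gE] : forall i, exists j, e j = f i.
    by move=> i; have [j _ <-] := ef i; exists j.
  by exists g.
exists (fun j => \sum_(i | g i == j) c i).
rewrite (partition_big g xpredT)//=; apply: eq_bigr => j _.
by rewrite scaler_suml; apply: eq_bigr => i /eqP <-; rewrite gE.
Qed.

(** If m < n, the matrix expressing e through f has a nonzero left kernel vector, which is a linear
    relation among the e. *)
Lemma lin_indep_le n m (e : 'I_n -> V) (f : 'I_m -> V) :
  lin_indep e -> range e `<=` lspan (range f) -> (n <= m)%N.
Proof.
move=> e0 ef; rewrite leqNgt; apply/negP => mn.
have /choice[A AE] : forall i, exists c : 'I_m -> R, e i = \sum_j c j *: f j.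
  by move=> i; apply/lspan_range/ef; exists i.
pose M : 'M[R]_(n, m) := \matrix_(i, j) A i j.
have : kermx M != 0.
  rewrite kermx_eq0 /row_free; apply: contraL mn => /eqP <-.
  by rewrite -leqNgt rank_leq_col.
case/rowV0Pn => u /sub_kermxP uM; case/eqP.
apply/rowP => i; rewrite mxE; apply: (e0 (fun i => u 0 i)) => {i}.
under eq_bigr do rewrite AE scaler_sumr.
rewrite exchange_big big1// => j _; under eq_bigr do rewrite scalerA.
rewrite -scaler_suml.
have -> : \sum_i u 0 i * A i j = 0; last by rewrite scale0r.
have /rowP/(_ j) := uM; rewrite [RHS]mxE mxE; apply: etrans.
by apply: eq_bigr => i _; rewrite mxE.
Qed.

(** [fdim] is chosen by [xget]; its value is pinned down by comparing the chosen basis with the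
    given one in both directions. *)
Lemma fdimE U (I : finType) (e : I -> V) :
  (forall c : I -> R, \sum_i c i *: e i = 0 -> forall i, c i = 0) ->
  U = lspan (range e) -> fdim U = #|I|.
Proof.
move=> e0 UE.
have re : range e = range (e \o @enum_val I I).
  apply/seteqP; split=> _ [i _ <-]; last by exists (enum_val i).
  by exists (enum_rank i) => //=; rewrite enum_rankK.
have e'0 : lin_indep (e \o @enum_val I I).
  move=> c; rewrite (reindex (@enum_rank I)) /=; last exact: onW_bij (enum_rank_bij I).
  under eq_bigr do rewrite enum_rankK.
  by move=> /e0 c0 i; rewrite -(enum_valK i).
have dU : has_dim U #|I| by exists (e \o enum_val); rewrite ?UE -?re.
have : has_dim U (fdim U) by exact: xgetPex (ex_intro _ _ dU).
move: (fdim U) => n [e' e'n Un].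
apply/eqP; rewrite eqn_leq; apply/andP; split.
  by apply: (lin_indep_le (f := e \o @enum_val I I) e'n) => x xe'; rewrite -re -UE Un;
    exact: sub_lspan.
apply: (lin_indep_le (f := e') e'0) => x xe; rewrite -Un UE re; exact: sub_lspan.
Qed.

End spans.

Section homogeneous.
Context {R : realType} (I : finType) (k : nat).

(* Rescaling the variables in [D] reduces to arbitrary positive values. *)
Lemma homogeneous_free (D : pred I) m (c : {ffun I -> 'I_k.+1} -> R) :
  (exists i, D i) ->
  (forall al, c al != 0 -> (\sum_(i | D i) al i = m)%N) ->
  (forall l : I -> R, (forall i, 0 < l i) -> \sum_(i | D i) l i = 1 ->
     \sum_al c al * \prod_i l i ^+ al i = 0) ->
  forall al, c al = 0.
Proof.
move=> [i0 Di0] cm c0; apply: positive_monomials_free => l l0.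
pose S := \sum_(i | D i) l i.
have S0 : 0 < S.
  rewrite /S (bigD1 i0)//= ltr_pwDl// sumr_ge0// => i _; exact: ltW.
pose l' i := if D i then l i / S else l i.
have l'0 i : 0 < l' i by rewrite /l'; case: (D i); rewrite ?divr_gt0.
have l'1 : \sum_(i | D i) l' i = 1.
  rewrite (eq_bigr (fun i => l i / S)); last by move=> i Di; rewrite /l' Di.
  by rewrite -mulr_suml divff// lt0r_neq0.
apply: (@etrans _ _ (S ^+ m * \sum_al c al * \prod_i l' i ^+ al i)); last first.
  by rewrite c0 ?mulr0.
rewrite mulr_sumr.
apply: eq_bigr => al _; have [->|/cm <-] := eqVneq (c al) 0.
  by rewrite !mul0r mulr0.
rewrite mulrCA; congr (_ * _).
rewrite expr_sum [X in _ = X * _]big_mkcond -big_split; apply: eq_bigr => i _ /=.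
rewrite /l'; case: (D i); last by rewrite mul1r.
by rewrite -exprMn mulrCA divff ?mulr1// lt0r_neq0.
Qed.

End homogeneous.

(** * Barycentric coordinates *)

Section barycentric.
Context {R : realType} {d : nat}.
Implicit Types (F K : {fset 'rV[R]_d}) (y v : 'rV[R]_d).

(** [bary] is a choice, which affine independence makes forced; later computations of [bary] just
    exhibit weights. *)
Lemma bary_uniq F (l : {ffun F -> R}) y : aff_indep F ->
  \sum_x l x = 1 -> \sum_x l x *: val x = y -> bary F y = l.
Proof.
move=> Fi l1 ly; rewrite /bary.
set P := [set _ | _]; have [b1 by_] : P (xget 0 P) by apply: (@xgetPex _ _ P); exists l.
apply/ffunP => x; apply/eqP; rewrite -subr_eq0; apply/eqP.
apply: (Fi (fun z => xget 0 P z - l z) _ _ x); first by rewrite sumrB b1 l1 subrr.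
by under eq_bigr do rewrite scalerBl; rewrite sumrB by_ ly subrr.
Qed.

Lemma bary_comb F (l : {ffun F -> R}) : aff_indep F -> \sum_x l x = 1 ->
  bary F (\sum_x l x *: val x) = l.
Proof. by move=> Fi l1; apply: bary_uniq. Qed.

Lemma simplex_bary F y : aff_indep F -> simplex F y ->
  [/\ forall x, 0 <= bary F y x, \sum_x bary F y x = 1 &
      \sum_x bary F y x *: val x = y].
Proof.
move=> Fi [c [c0 c1 ->]].
have -> : \sum_(x : F) c x *: \val x = \sum_(x : F) [ffun x => c x] x *: \val x.
  by apply: eq_bigr => x _; rewrite ffunE.
have c1' : \sum_x [ffun x => c x] x = 1.
  by rewrite -c1; apply: eq_bigr => x _; rewrite ffunE.
by rewrite (bary_comb Fi)//; split=> // x; rewrite ffunE.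
Qed.

Lemma big_face (T : Type) (idx : T) (op : Monoid.com_law idx) F K
    (FK : (F `<=` K)%fset) (G : K -> T) :
  \big[op/idx]_(x : K | val x \in F) G x = \big[op/idx]_(x : F) G (fincl FK x).
Proof.
rewrite -(@big_imset _ _ _ _ _ (fincl FK) predT G) /=; last first.
  by move=> x x' _ _; exact: fincl_inj.
apply: eq_bigl => x; apply/idP/imsetP => [xF|[x' _ ->]]; last first.
  exact: (valP x').
by exists [` xF]%fset => //; apply/val_inj.
Qed.

Lemma aff_indep_sub F K : (F `<=` K)%fset -> aff_indep K -> aff_indep F.
Proof.
move=> FK Ki c c0 cx x.
pose c' (z : K) := if insub (val z) is Some z' then c z' else 0.
have c'E z : c' (fincl FK z) = c z.
  by rewrite /c' (_ : val (fincl FK z) = val z)// valK.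
have c'0 (z : K) : val z \notin F -> c' z = 0 by move=> zF; rewrite /c' insubN.
rewrite -c'E; apply: Ki.
  rewrite (bigID (fun z : K => val z \in F)) /= [X in _ + X]big1// addr0.
  by rewrite (big_face _ FK) -[RHS]c0; apply: eq_bigr.
rewrite (bigID (fun z : K => val z \in F)) /= [X in _ + X]big1 ?addr0; last first.
  by move=> z /c'0 ->; rewrite scale0r.
by rewrite (big_face _ FK) -[RHS]cx; apply: eq_bigr => z _; rewrite c'E.
Qed.

Lemma bary_face F K (FK : (F `<=` K)%fset) y (l : {ffun F -> R}) :
  aff_indep K -> \sum_x l x = 1 -> \sum_x l x *: val x = y ->
  (forall x, bary K y (fincl FK x) = l x) /\
  (forall x : K, val x \notin F -> bary K y x = 0).
Proof.
move=> Ki l1 ly.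
pose l' : {ffun K -> R} :=
    [ffun z : K => (if insub (val z) is Some z' then l z' else 0) : R].
have l'E z : l' (fincl FK z) = l z.
  by rewrite /l' ffunE (_ : val (fincl FK z) = val z)// valK.
have l'0 (z : K) : val z \notin F -> l' z = 0.
  by move=> zF; rewrite /l' ffunE insubN.
suff -> : bary K y = l' by split.
apply: (bary_uniq Ki).
  rewrite (bigID (fun z : K => val z \in F)) /= [X in _ + X]big1// addr0.
  by rewrite (big_face _ FK) -[RHS]l1; apply: eq_bigr.
rewrite (bigID (fun z : K => val z \in F)) /= [X in _ + X]big1 ?addr0; last first.
  by move=> z /l'0 ->; rewrite scale0r.
by rewrite (big_face _ FK) -ly; apply: eq_bigr => z _; rewrite l'E.
Qed.

Lemma bary_simplex_face F K (FK : (F `<=` K)%fset) y :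
  aff_indep K -> simplex F y ->
  (forall x, bary K y (fincl FK x) = bary F y x) /\
  (forall x : K, val x \notin F -> bary K y x = 0).
Proof.
move=> Ki /(simplex_bary (aff_indep_sub FK Ki))[_ b1 by_].
exact: bary_face.
Qed.

Section nondegenerate.
Variable K : {fset 'rV[R]_d}.
Hypothesis Kn : nondegenerate_simplex K.
Let Ki : aff_indep K := Kn.2.

(** The matrix with rows (1, x), x a vertex, is square, and its rows are free by affine
    independence; so every (1, y) is a combination of them. *)
Lemma bary_total y : \sum_x bary K y x = 1 /\ \sum_x bary K y x *: val x = y.
Proof.
have card_K : #|{: K}| = (1 + d)%N by rewrite -cardfE Kn.1.
pose M : 'M[R]_(#|{: K}|, 1 + d) :=
  \matrix_i row_mx 1 (val (enum_val i : K)).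
have Mfree : row_free M.
  rewrite -kermx_eq0; apply/eqP/row_matrixP => i; rewrite row0.
  have /sub_kermxP : (row i (kermx M) <= kermx M)%MS by exact: row_sub.
  move: (row i _) => u; rewrite mulmx_sum_row.
  under eq_bigr do rewrite rowK scale_row_mx.
  move=> /eqP; rewrite -[X in _ == X]hsubmxK -[X in X == _]hsubmxK => /eqP /eq_row_mx[].
  rewrite !linear_sum !linear0 /= => e1 e2.
  apply/rowP => j; rewrite mxE -(enum_valK j).
  apply: (Ki (c := fun x : K => u 0 (enum_rank x)) _ _ (enum_val j)).
    rewrite (reindex (@enum_val K K)) /=; last exact: onW_bij (enum_val_bij K).
    have /rowP/(_ 0) := e1; rewrite summxE mxE ; apply: etrans; apply: eq_bigr => i' _.
    by rewrite row_mxKl mxE mxE eqxx mulr1 enum_valK.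
  rewrite (reindex (@enum_val K K)) /=; last exact: onW_bij (enum_val_bij K).
  by rewrite -[RHS]e2; apply: eq_bigr => i' _; rewrite row_mxKr enum_valK.
have Mfull : row_full M by rewrite /row_full (eqP Mfree) card_K.
have [u uE] : exists u, row_mx 1 y = u *m M by apply/submxP/submx_full.
pose l : {ffun K -> R} := [ffun x : K => u 0 (enum_rank x)].
move: uE; rewrite mulmx_sum_row; under eq_bigr do rewrite rowK scale_row_mx.
move=> /eqP; rewrite -[X in _ == X]hsubmxK => /eqP /eq_row_mx[].
rewrite !linear_sum /= => e1 e2.
have l1 : \sum_x l x = 1.
  rewrite (reindex (@enum_val K K)) /=; last exact: onW_bij (enum_val_bij K).
  have /rowP/(_ 0) := e1; rewrite summxE mxE eqxx => e.
  apply: (etrans _ (esym e)); apply: eq_bigr => i' _.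
  by rewrite row_mxKl mxE mxE eqxx mulr1 ffunE enum_valK.
have ly : \sum_x l x *: val x = y.
  rewrite (reindex (@enum_val K K)) /=; last exact: onW_bij (enum_val_bij K).
  by rewrite e2; apply: eq_bigr => i' _; rewrite row_mxKr ffunE enum_valK.
by rewrite (bary_uniq Ki l1 ly).
Qed.

(** Coordinates are affine, not linear: subtracting a times those of 0 brings the total weight back
    to 1 without moving the point. *)
Lemma bary_affine a (x y : 'rV[R]_d) : bary K (a *: x + y) =
  [ffun z => a * bary K x z + bary K y z - a * bary K 0 z].
Proof.
have [x1 xE] := bary_total x; have [y1 yE] := bary_total y.
have [z1 zE] := bary_total 0.
apply: (bary_uniq Ki); under eq_bigr do rewrite ffunE.
  by rewrite sumrB big_split /= -!mulr_sumr x1 y1 z1 addrAC subrr add0r.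
under eq_bigr do rewrite scalerBl scalerDl -!scalerA.
by rewrite sumrB big_split /= -!scaler_sumr xE yE zE scaler0 subr0.
Qed.

Definition bary_lin v z : R := bary K v z - bary K 0 z.

Lemma bary_linP a v w z :
  bary_lin (a *: v + w) z = a * bary_lin v z + bary_lin w z.
Proof. by rewrite /bary_lin bary_affine ffunE; ring. Qed.

Lemma bary_lin_sum m (c : 'I_m -> R) (v : 'I_m -> 'rV[R]_d) z :
  bary_lin (\sum_i c i *: v i) z = \sum_i c i * bary_lin (v i) z.
Proof.
elim/big_rec2: _ => [|i a w _ IH]; first by rewrite /bary_lin subrr.
by rewrite bary_linP IH.
Qed.

Lemma bary_add (x : 'rV[R]_d) v z : bary K (x + v) z = bary K x z + bary_lin v z.
Proof. by rewrite -[x]scale1r bary_affine ffunE scale1r mul1r mul1r /bary_lin addrA. Qed.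

Lemma bary_frame s (N : 'M[R]_(s, d)) (x : 'rV[R]_d) t z : bary K (x + t *m N) z =
  bary K x z + \sum_j t 0 j * bary_lin (row j N) z.
Proof. by rewrite bary_add mulmx_sum_row bary_lin_sum. Qed.

Lemma polyfun_bary z : polyfun geq 1 (fun y => bary K y z).
Proof.
apply: (@eq_polyfun _ _ _ _
  (fun y => bary K 0 z + \sum_j y 0 j * bary_lin (row j 1%:M) z)).
  by move=> y; rewrite -bary_frame add0r mulmx1.
apply: polyfunD; last exact: polyfun_linear.
by apply: (@polyfun_weaken _ _ geq _ 0) => [[]//|]; exact: polyfun_cst.
Qed.

Lemma polyfun_bary_frame s (N : 'M[R]_(s, d)) (x : 'rV[R]_d) z :
  polyfun leq 0 (fun t : 'rV[R]_s => bary K (x + t *m N) z).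
Proof.
apply: (@eq_polyfun _ _ _ _
  (fun t => bary K x z + \sum_j t 0 j * bary_lin (row j N) z)).
  by move=> t; rewrite -bary_frame.
apply: polyfunD; first exact: polyfun_cst.
by apply: (@polyfun_weaken _ _ leq _ 1) => //; exact: polyfun_linear.
Qed.

Lemma polyfun_bary_frame1 (rho : rel nat) s (N : 'M[R]_(s, d)) (x : 'rV[R]_d) z : rho 1 1%N ->
  bary K x z = 0 -> polyfun rho 1 (fun t : 'rV[R]_s => bary K (x + t *m N) z).
Proof.
move=> rho1 xz; apply: (@eq_polyfun _ _ _ _
  (fun t => \sum_j t 0 j * bary_lin (row j N) z)).
  by move=> t; rewrite bary_frame xz add0r.
exact: polyfun_linear.
Qed.

End nondegenerate.
End barycentric.

(** * Bernstein bases *)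

Lemma fdim_cond {R : realType} {V : lmodType R} (U : set V) (I : finType)
    (P : pred I) (e : I -> V) :
  (forall c : I -> R, \sum_(i | P i) c i *: e i = 0 -> forall i, P i -> c i = 0) ->
  U = lspan [set e i | i in [set i | P i]] -> fdim U = #|P|.
Proof.
move=> e0 UE; rewrite -[RHS]card_ord.
apply: (@fdimE _ _ _ _ (e \o @enum_val I P)) => [c c0 j|]; last first.
  rewrite UE; congr lspan; apply/seteqP; split=> v [i].
    by move=> /= Pi <-; exists (enum_rank_in (Pi : i \in P) i) => //=; rewrite enum_rankK_in.
  by move=> _ <-; exists (enum_val i) => //=; have := enum_valP i.
pose c' i := \sum_(j | @enum_val I P j == i) c j.
have -> : c j = c' (enum_val j).
  by rewrite /c' (big_pred1 j)// => j'; rewrite (inj_eq enum_val_inj).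
apply: e0; last by have := enum_valP j.
have PE (j' : 'I_#|P|) : true -> P (enum_val j') by move=> _; exact: enum_valP j'.
apply: etrans c0; rewrite [RHS](partition_big (@enum_val I P) P PE).
apply: eq_bigr => i _; rewrite scaler_suml.
by apply: eq_bigr => i' /eqP <-.
Qed.

Section bernstein.
Context {R : realType} {d : nat}.
Implicit Types (F K : {fset 'rV[R]_d}).

Lemma fun_sumE (T : Type) (I : Type) (r : seq I) (P : pred I) (c : I -> R)
    (f : I -> T -> R) (x : T) :
  (\sum_(i <- r | P i) c i *: f i) x = \sum_(i <- r | P i) c i * f i x.
Proof. by rewrite fct_sumE. Qed.

Lemma poly_spaceE k : poly_space k = polyfun geq k :> set ('rV[R]_d -> R).
Proof.
apply/seteqP; split=> [f [n [c [e [eP ->]]]]|_ [I [c [a [ak ->]]]]].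
  have -> : \sum_i c i *: e i = (fun x => \sum_i c i * e i x).
    by apply/funext => x; rewrite fun_sumE.
  apply: polyfun_sum => i _; apply: polyfunZ.
  have [a ak ->] := eP i.
  apply: (@eq_polyfun _ _ _ _ (mono (finfun a))).
    by move=> x; rewrite /mono; apply: eq_bigr => j _; rewrite ffunE.
  apply: polyfun_mono; rewrite /mdeg /=.
  by under eq_bigr do rewrite ffunE.
have -> : (fun x : 'rV[R]_d => \sum_i c i * mono (a i) x) = \sum_i c i *: mono (a i).
  by apply/funext => x; rewrite fun_sumE.
by apply: lspan_sum => i; exists (a i) => //; exact: ak.
Qed.

Definition bern K k (al : {ffun K -> 'I_k.+1}) (y : 'rV[R]_d) : R :=
  \prod_x bary K y x ^+ al x.

Lemma poly_space_bern K k (al : {ffun K -> 'I_k.+1}) : nondegenerate_simplex K ->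
  (\sum_x al x = k)%N -> poly_space k (bern al).
Proof.
move=> Kn alk; rewrite poly_spaceE.
have := @polyfun_prod R d geq K (index_enum _) xpredT (fun x => (al x * 1)%N)
  (fun x y => bary K y x ^+ al x) additive_geq.
under eq_bigr do rewrite muln1.
by rewrite alk; apply => x _; apply: polyfunX; [exact: additive_geq|exact: polyfun_bary].
Qed.

(** Homogenization: each Cartesian coordinate is a linear form [lin] in the barycentric ones, and
    their sum [one] equals 1, so multiplying a monomial by its missing power of [one] raises the
    degree to k without changing the value. *)
Lemma bernstein_expansion K k (u : 'rV[R]_d -> R) : nondegenerate_simplex K ->
  poly_space k u -> exists2 c : {ffun K -> 'I_k.+1} -> R,
    forall al, c al != 0 -> (\sum_x al x = k)%N &
    u = fun y => \sum_al c al * bern al y.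
Proof.
move=> Kn; rewrite poly_spaceE => -[I [b [a [ak ->]]]].
pose z y : 'rV[R]_#|{: K}| := \row_i bary K y (enum_val i).
pose lin j (t : 'rV[R]_#|{: K}|) := \sum_i t 0 i * (val (enum_val i : K) 0 j : R).
pose one (t : 'rV[R]_#|{: K}|) := \sum_i t 0 i * (1 : R).
have oneE y : one (z y) = 1.
  have [b1 _] := bary_total Kn y; rewrite -[RHS]b1 /one.
  rewrite [RHS](reindex (@enum_val K K)) /=; last exact: onW_bij (enum_val_bij K).
  by apply: eq_bigr => i _; rewrite mulr1 mxE.
have linE y j : lin j (z y) = y 0 j.
  have [_ by_] := bary_total Kn y; rewrite -[in RHS]by_ /lin summxE.
  rewrite [RHS](reindex (@enum_val K K)) /=; last exact: onW_bij (enum_val_bij K).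
  by apply: eq_bigr => i _; rewrite !mxE.
pose g t := \sum_i b i * ((\prod_j lin j t ^+ a i j) * one t ^+ (k - mdeg (a i))).
have gE y : \sum_i b i * mono (a i) y = g (z y).
  apply: eq_bigr => i _; rewrite oneE expr1n mulr1; congr (_ * _).
  by apply: eq_bigr => j _; rewrite linE.
have [J [c [e [ek gJ]]]] : polyfun eq_op k g.
  apply: polyfun_sum => i _; apply: polyfunZ.
  apply: (@polyfunM _ _ eq_op eq_op eq_op
      (\sum_j (a i j * 1)) ((k - mdeg (a i)) * 1)).
  - move=> p q /eqP <- /eqP <-; rewrite muln1; under eq_bigr do rewrite muln1.
    by rewrite subnKC//; exact: ak.
  - apply: polyfun_prod => [|j _]; first exact: additive_eq.
    by apply: polyfunX; [exact: additive_eq|exact: polyfun_linear].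
  - by apply: polyfunX; [exact: additive_eq|exact: polyfun_linear].
have ele j x : (e j (enum_rank x) < k.+1)%N.
  rewrite ltnS (eqP (ek j)) /mdeg (bigD1 (enum_rank x))//=; exact: leq_addr.
pose key j : {ffun K -> 'I_k.+1} := [ffun x => inord (e j (enum_rank x))].
have keyE j x : key j x = e j (enum_rank x) :> nat by rewrite /key ffunE inordK.
exists (fun al => \sum_(j | key j == al) c j) => [al|].
  apply: contraNeq => alk; rewrite big_pred0// => j; apply: contraNF alk => /eqP <-.
  apply/eqP; rewrite [RHS](eqP (ek j)) /mdeg; under eq_bigr do rewrite keyE.
  by rewrite [RHS](reindex (@enum_rank K)) //=; exact: onW_bij (enum_rank_bij K).
apply/funext => y; rewrite gE gJ (partition_big key xpredT)//=.
apply: eq_bigr => al _; rewrite mulr_suml; apply: eq_bigr => j /eqP <-.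
congr (_ * _); rewrite /mono (reindex (@enum_rank K)) /=; last first.
  exact: onW_bij (enum_rank_bij K).
by apply: eq_bigr => x _; rewrite mxE enum_rankK keyE.
Qed.

(** Positive weights of total 1 are the barycentric coordinates of points inside F, and homogeneity
    makes such arguments suffice. *)
Lemma bern_free F k m (c : {ffun F -> 'I_k.+1} -> R) :
  aff_indep F -> F != fset0 ->
  (forall al, c al != 0 -> (\sum_x al x = m)%N) ->
  (forall y, simplex F y -> (forall x, 0 < bary F y x) ->
    \sum_al c al * bern al y = 0) ->
  forall al, c al = 0.
Proof.
move=> Fi /fset0Pn[x0 x0F] cm c0.
apply: (@homogeneous_free _ _ _ predT m) => [| |l l0 l1].
- by exists [` x0F]%fset.
- by move=> al /cm.
pose l' : {ffun F -> R} := finfun l.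
have l'1 : \sum_x l' x = 1 by rewrite -l1; apply: eq_bigr => x _; rewrite ffunE.
have bE := bary_comb Fi l'1.
apply: etrans (c0 (\sum_x l' x *: val x) _ _).
- apply: eq_bigr => al _; congr (_ * _); apply: eq_bigr => x _.
  by rewrite bE ffunE.
- by exists l'; split=> // x; rewrite ffunE ltW.
- by move=> x; rewrite bE ffunE.
Qed.

Lemma fdim_poly_space K k : nondegenerate_simplex K ->
  fdim (poly_space k : set ('rV[R]_d -> R)) =
  #|[pred al : {ffun K -> 'I_k.+1} | \sum_x al x == k]%N|.
Proof.
move=> Kn; have K0 : K != fset0 by rewrite -cardfs_gt0 Kn.1.
apply: (@fdim_cond _ _ _ _ _ (@bern K k)) => [c c0 al alk|].
  pose c' (be : {ffun K -> 'I_k.+1}) := if (\sum_x be x == k)%N then c be else 0.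
  have -> : c al = c' al by rewrite /c' (alk : (\sum_x al x == k)%N).
  apply: (bern_free (m := k) Kn.2 K0) => [be|y _ _].
    by rewrite /c'; case: ifP => [/eqP//|]; rewrite eqxx.
  have := congr1 (fun f : 'rV[R]_d -> R => f y) c0; rewrite fun_sumE big_mkcond /=.
  apply: etrans; apply: eq_bigr => be _; rewrite /c'.
  by case: ifP => //; rewrite mul0r.
apply/seteqP; split=> [u /(bernstein_expansion Kn)[c ck ->]|].
  have -> : (fun y => \sum_al c al * bern al y) =
      \sum_(al : {ffun K -> 'I_k.+1} | (\sum_x al x == k)%N) c al *: @bern K k al.
    apply/funext => y; rewrite fun_sumE [RHS]big_mkcond; apply: eq_bigr => al _ /=.
    by case: ifPn => //; apply: contraNeq; rewrite mulf_eq0 negb_or => /andP[/ck -> _].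
  by apply: lspan_bigsum => al alk; exists al.
by apply: lspan_sub => _ [al /eqP alk <-]; exact: poly_space_bern.
Qed.

Lemma bubbleE r k F n : bubble r k F n =
  lspan [set (@bern F k al) \_ (simplex F) | al in
    [set al | @bubble_index k F (k - n)%N (fun l => (r (codim F + l) - n)%N) al]].
Proof.
rewrite /bubble; congr lspan; apply/seteqP; split=> f []; last first.
  by move=> al /bubble_indexP aP <-; exists (fun x => val (al x)).
move=> sg [sk sJ] ->.
have slt x : (sg x < k.+1)%N.
  by rewrite ltnS (leq_trans _ (leq_subr n k))// -sk (bigD1 x)//= leq_addr.
have sE x : val ([ffun x => inord (sg x)] x : 'I_k.+1) = sg x by rewrite ffunE /= inordK.
exists [ffun x => inord (sg x)] => /=.
  apply/bubble_indexP; rewrite (_ : (fun x => _) = sg)//.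
  by apply/funext => x; rewrite sE.
congr (_ \_ _); apply/funext => y; apply: eq_bigr => x _; by rewrite sE.
Qed.

Lemma fdim_bubble r k F n : aff_indep F -> F != fset0 ->
  fdim (bubble r k F n) =
  #|@bubble_index k F (k - n)%N (fun l => (r (codim F + l) - n)%N)|.
Proof.
move=> Fi F0; apply: fdim_cond (bubbleE _ _ _ _) => c c0 al aP.
pose P := @bubble_index k F (k - n)%N (fun l => (r (codim F + l) - n)%N).
pose c' (be : {ffun F -> 'I_k.+1}) := if P be then c be else 0.
have -> : c al = c' al by rewrite /c' [P al]aP.
apply: (bern_free (m := (k - n)%N) Fi F0) => [be|y yF _].
  by rewrite /c'; case: ifP => [/andP[/eqP//]|]; rewrite eqxx.
have := congr1 (fun f : 'rV[R]_d -> R => f y) c0; rewrite fun_sumE big_mkcond /=.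
apply: etrans; apply: eq_bigr => be _; rewrite /c' -/P patchE mem_set//.
by case: ifP => //; rewrite mul0r.
Qed.

End bernstein.

(** * The dimension count *)

Lemma perm_fpowerset (T : choiceType) (K : {fset T}) :
  perm_eq (enum_fset (fpowerset K))
    [seq [fset val x | x in D]%fset | D : {set K}].
Proof.
apply: uniq_perm; first exact: fset_uniq.
  rewrite map_inj_uniq ?enum_uniq// => D D' e.
  by rewrite -[D]FSetK e FSetK.
move=> F; rewrite -[LHS]/(F \in fpowerset K) fpowersetE.
apply/idP/mapP => [FK|[D _ ->]].
  by exists (fsub K F); rewrite ?mem_enum// fsubK.
by apply/fsubsetP => x /imfsetP[y _ ->]; exact: fsvalP.
Qed.

Lemma num_dofsE (R : realType) (d : nat) (r : nat -> nat) (k : nat)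
    (K : {fset 'rV[R]_d}) :
  (forall i, (1 <= i < d)%N ->
     (2 ^ (d - i) * r i <= 2 ^ (d - i.+1) * r i.+1)%N) ->
  (2 * r d + 1 <= k)%N -> nondegenerate_simplex K ->
  num_dofs r k K = fdim (poly_space k : set ('rV[R]_d -> R)).
Proof.
move=> r_growth k_large Kn.
have card_K : #|{: K}| = d.+1 by rewrite -cardfE Kn.1.
rewrite (fdim_poly_space k Kn) -(card_face_cond_total r_growth k_large card_K).
rewrite /num_dofs (perm_big _ (perm_fpowerset K)) /= big_image_cond /=.
have sub (D : {set K}) : ([fset val x | x in D] `<=` K)%fset.
  by apply/fsubsetP => x /imfsetP[y _ ->]; exact: fsvalP.
apply: eq_big => D; first by rewrite -(fsub_eq0 (sub D)) FSetK.
have FK := sub D; set F := [fset val x | x in D]%fset in FK * => F0.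
(* [card_face_cond] describes a face as the image of an injection, here the inclusion of F into
   K. *)
have DF : imset (fincl FK) (mem (finset.setTfor F)) = D.
  by rewrite -[RHS]FSetK (fsubE FK); apply/finset.setP => x;
    apply/imsetP/imsetP => -[y _ ->]; exists y; rewrite ?inE.
have codimE : codim F = #|finset.setC D|.
  by rewrite /codim -card_K -(card_fsub FK) FSetK [RHS]cardsCs finset.setCK.
rewrite codimE; apply: eq_bigr => n _.
rewrite fdim_bubble//; last exact: aff_indep_sub FK Kn.2.
have := card_face_cond r_growth k_large (@fincl_inj _ _ _ FK) card_K.
rewrite DF codimE => ->//.
  by rewrite -(fsub_eq0 FK) FSetK in F0.
by rewrite -ltnS ltn_ord.
Qed.

(** * Lebesgue measure on the unit simplex *)

Section lebesgue_tuple.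
Context {R : realType}.

Definition cube m (a : 'I_m -> R) (e : R) : set (m.-tuple R) :=
  [set t | forall i, a i <= tnth t i <= a i + e].

Lemma measurable_forall_tnth m (A : 'I_m -> set R) : (forall i, measurable (A i)) ->
  measurable [set t : m.-tuple R | forall i, A i (tnth t i)].
Proof.
move=> mA; have -> : [set t : m.-tuple R | forall i, A i (tnth t i)] =
    \bigcap_(i in [set: 'I_m]) ((fun t => tnth t i) @^-1` A i).
  by apply/seteqP; split => [t At i _|t At i]; [exact: At|exact: (At i)].
apply: fin_bigcap_measurable => // i _.
by rewrite -[X in measurable X]setTI; exact: measurable_tnth.
Qed.

Lemma measurable_cube m (a : 'I_m -> R) e : measurable (cube a e).
Proof.
have -> : cube a e = [set t | forall i, `[a i, a i + e]%classic (tnth t i)].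
  by apply/seteqP; split=> t ta i; have := ta i; rewrite /= in_itv.
by apply: (measurable_forall_tnth (A := fun i => `[a i, a i + e]%classic)) => i.
Qed.

Lemma lebesgue_tuple_cube m (a : 'I_m -> R) e : 0 < e ->
  lebesgue_tuple m (cube a e) = (e ^+ m)%:E.
Proof.
move=> e0; elim: m a => [|m IH] a.
  rewrite /= /dirac indicE mem_set//; by move=> [].
have -> : lebesgue_tuple m.+1 (cube a e) =
    (lebesgue_measure \x lebesgue_tuple m)%E
      (`[a ord0, a ord0 + e]%classic `*` cube (a \o lift ord0) e).
  rewrite /= /lebesgue_step /pushforward; congr (_ _).
  apply/seteqP; split=> [[x t] xt|[x t] [/= xa ta]].
    split=> /= [|i]; first by have := xt ord0; rewrite tnth0 in_itv.
    by have := xt (lift ord0 i); rewrite tnthS.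
  move=> i; have [j ->|->] := unliftP ord0 i; rewrite ?tnthS ?tnth0.
    exact: ta.
  by move: xa; rewrite in_itv.
rewrite product_measure1E ?IH//; last exact: measurable_cube.
rewrite exprS EFinM; congr (_ * _)%E.
apply: etrans (lebesgue_measure_itv _) _.
by rewrite /= lte_fin ltrDl e0 -EFinB addrAC subrr add0r.
Qed.

Lemma measurable_polyfun m rho n (f : 'rV[R]_m -> R) D : polyfun rho n f ->
  measurable_fun D (f \o @row_of_tuple R m).
Proof.
move=> [I [c [a [_ ->]]]]; apply: (@measurable_funTS _ _ _ _ D).
rewrite /comp; apply: measurable_sum => i; apply: measurable_funM.
  exact: measurable_cst.
apply: measurable_prod => j _.
have -> : (fun x : m.-tuple R => row_of_tuple x 0 j ^+ a i j) = (fun x => tnth x j ^+ a i j).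
  by apply/funext => x; rewrite mxE.
by apply: measurable_funX; exact: measurable_tnth.
Qed.

Lemma measurable_unit_simplex m : measurable (@unit_simplex R m).
Proof.
have -> : @unit_simplex R m = [set t : m.-tuple R | forall i, `[0, +oo[%classic (tnth t i)] `&`
   ((fun x : 'rV[R]_m => \sum_i x 0 i * 1) \o row_of_tuple) @^-1` `]-oo, 1]%classic.
  apply/seteqP; split=> [t [t0 t1]|t [t0 t1]]; split=> /=.
  - by move=> i; rewrite in_itv /= t0.
  - rewrite in_itv /=; apply: le_trans t1.
    by rewrite le_eqVlt; apply/orP; left; apply/eqP/eq_bigr => i _; rewrite mxE mulr1.
  - by move=> i; have := t0 i; rewrite /= in_itv /= andbT.
  - move: t1; rewrite /= in_itv /=; apply: le_trans.
    by rewrite le_eqVlt; apply/orP; left; apply/eqP/eq_bigr => i _; rewrite mxE mulr1.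
apply: measurableI; first exact: (measurable_forall_tnth (A := fun=> `[0, +oo[%classic)).
rewrite -[X in measurable X]setTI.
apply: (@measurable_polyfun _ eq_op 1%N) => //.
exact: polyfun_linear.
Qed.

Lemma unit_simplex_cube m : @unit_simplex R m `<=` cube (fun=> 0) 1.
Proof.
move=> t [t0 t1] i; rewrite t0 add0r; apply: le_trans t1.
by rewrite (bigD1 i)//= lerDl sumr_ge0.
Qed.

Lemma unit_simplex_finite m : (lebesgue_tuple m (@unit_simplex R m) < +oo)%E.
Proof.
apply: (@le_lt_trans _ _ (lebesgue_tuple m (cube (fun=> 0) (1 : R)))).
  apply: le_measure; rewrite ?inE; [exact: measurable_unit_simplex|exact: measurable_cube|].
  exact: unit_simplex_cube.
by rewrite lebesgue_tuple_cube// ltry.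
Qed.

Lemma integrable_polyfun m rho n (f : 'rV[R]_m -> R) : polyfun rho n f ->
  (lebesgue_tuple m).-integrable (@unit_simplex R m) (EFin \o (f \o @row_of_tuple R m)).
Proof.
move=> pf; apply: measurable_bounded_integrable.
- exact: measurable_unit_simplex.
- exact: unit_simplex_finite.
- exact: measurable_polyfun pf.
move: pf => [I [c [a [_ ->]]]].
exists (\sum_i `|c i|); split; first exact: num_real.
move=> M cM t tS /=; apply: le_trans (ltW cM).
apply: le_trans (ler_norm_sum _ _ _) _; apply: ler_sum => i _.
rewrite normrM ler_piMr// /mono normr_prod.
rewrite -[leRHS](@big1_eq _ 1 *%R _ (index_enum 'I_m) xpredT).
apply: ler_prod => j _; rewrite normr_ge0 normrX exprn_ile1//= mxE.
have := unit_simplex_cube tS j; rewrite add0r => /andP[t0 t1].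
by rewrite ger0_norm.
Qed.

(** If f is nonzero at an interior point t, then by continuity its square exceeds half its value at
    t on a small cube with lower corner t; the volume of that cube bounds the integral away from
    0. *)
Lemma Rintegral_sqr_eq0 m (f : 'rV[R]_m -> R) : polyfun leq 0 f ->
  \int[lebesgue_tuple m]_(t in @unit_simplex R m) (f (row_of_tuple t) ^+ 2) = 0 ->
  forall t : m.-tuple R, (forall i, 0 < tnth t i) -> \sum_i tnth t i < 1 ->
    f (row_of_tuple t) = 0.
Proof.
move=> pf int0 t t0 t1; apply/eqP; apply: contraPT int0 => ft0.
pose g x := f x ^+ 2.
have pg : polyfun leq 0 g by have := polyfunX 2 additive_leq pf.
have gt0 : 0 < g (row_of_tuple t) by rewrite exprn_even_gt0.
have /(cvgr_gt _)/(_ (g (row_of_tuple t) / 2)) := continuous_polyfun pg (x := row_of_tuple t).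
rewrite ltr_pdivrMr// ltr_pMr// ltr1n => /(_ isT).
move=> /nbhs_ballP[e /= e0 be].
pose s := 1 - \sum_i tnth t i.
have s0 : 0 < s by rewrite subr_gt0.
(* The first bound keeps the cube in the ball given by continuity, the second keeps the coordinate
   sums at most 1; m + 1 instead of m also covers m = 0. *)
pose e' := Num.min (e / 2) (s / m.+1%:R).
have e'0 : 0 < e' by rewrite lt_min !divr_gt0.
pose Q := cube (tnth t) e'.
have QS : Q `<=` @unit_simplex R m.
  move=> u uQ; split=> [i|].
    by have /andP[tu _] := uQ i; exact: le_trans (ltW (t0 i)) tu.
  apply: (@le_trans _ _ (\sum_i (tnth t i + e'))).
    by apply: ler_sum => i _; have /andP[] := uQ i.
  rewrite big_split /= sumr_const card_ord -lerBrDl -/s -mulr_natr.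
  apply: (@le_trans _ _ (e' * m.+1%:R)).
    by rewrite ler_pM2l// ler_nat.
  by rewrite -ler_pdivlMr ?ltr0n// ge_min lexx orbT.
pose c := g (row_of_tuple t) / 2.
have c0 : 0 < c by rewrite divr_gt0.
have gQ u : Q u -> c <= g (row_of_tuple u).
  move=> uQ; apply/ltW/be; split=> // i j; rewrite !mxE /ball /=.
  have /andP[tu ut] := uQ j.
  rewrite distrC ger0_norm ?subr_ge0// ltrBlDl; apply: le_lt_trans ut _.
  rewrite ltrD2l; apply: (@le_lt_trans _ _ (e / 2)); first by rewrite ge_min lexx.
  by rewrite ltr_pdivrMr// ltr_pMr// ltr1n.
have gi := integrable_polyfun pg.
have mS : measurable (@unit_simplex R m) by exact: measurable_unit_simplex.
have mQ : measurable Q by exact: measurable_cube.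
apply/eqP; rewrite /Rintegral fine_eq0 ?integrable_fin_num//.
rewrite gt_eqF//; apply: (@lt_le_trans _ _ (c%:E * lebesgue_tuple m Q)%E).
  by rewrite lebesgue_tuple_cube// -EFinM lte_fin mulr_gt0// exprn_gt0.
rewrite -(integral_cst _ mQ).
have mg D : measurable_fun D (EFin \o (g \o @row_of_tuple R m)).
  by apply/measurable_EFinP; exact: measurable_polyfun pg.
apply: (@le_trans _ _ (\int[lebesgue_tuple m]_(u in Q) (g (row_of_tuple u))%:E)%E).
  apply: ge0_le_integral => //.
  - by move=> u _; rewrite lee_fin ltW.
apply: ge0_subset_integral => //.
by move=> u _; rewrite lee_fin sqr_ge0.
Qed.

End lebesgue_tuple.

(** * Integration on a face *)

Lemma det_pos_def (R : realType) m (A : 'M[R]_m) :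
  (forall x : 'rV[R]_m, x != 0 -> 0 < (x *m A *m x^T) 0 0) -> 0 < \det A.
Proof.
move=> A0.
(* The determinant of [(1 - s) I + s A] has no zero for [0 <= s <= 1]. *)
pose P : 'M[{poly R}]_m := (1 - 'X)%:M + 'X *: map_mx polyC A.
have PE s : (\det P).[s] = \det ((1 - s)%:M + s *: A).
  rewrite -[LHS]/(horner_eval s (\det P)) -det_map_mx; congr (\det _).
  apply/matrixP => i j; rewrite !mxE.
  by rewrite -[LHS]/(_.[s]) !hornerE hornerMn !hornerE.
have nz s : 0 <= s <= 1 -> (\det P).[s] != 0.
  case/andP => s0 s1; rewrite PE -unitfE -[_ \is a _]/(_ \in unitmx) -row_free_unit -kermx_eq0.
  apply/eqP/row_matrixP => i; rewrite row0.
  have /sub_kermxP : (row i (kermx ((1 - s)%:M + s *: A)) <=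
      kermx ((1 - s)%:M + s *: A))%MS by exact: row_sub.
  move: (row i _) => x xA; apply/eqP/negP => /negP x0.
  have : (x *m ((1 - s)%:M + s *: A) *m x^T) 0 0 = 0 by rewrite xA mul0mx mxE.
  rewrite mulmxDr mulmxDl mul_mx_scalar -scalemxAr -!scalemxAl mxE [X in X + _]mxE [X in _ + X]mxE.
  apply/eqP; rewrite gt_eqF//.
  have xx : 0 < (x *m x^T) 0 0.
    rewrite mxE; have [j xj] := rV0Pn _ x0.
    rewrite (bigD1 j)//= mxE -expr2 ltr_pwDl ?exprn_even_gt0 ?sumr_ge0// => l _.
    by rewrite mxE -expr2 sqr_ge0.
  have [->|sn0] := eqVneq s 0; first by rewrite subr0 mul1r mul0r addr0.
  by rewrite ltr_wpDl ?mulr_ge0 ?subr_ge0// ?(ltW xx)// mulr_gt0 ?A0// lt_def sn0.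
rewrite ltNge; apply/negP => det0.
have [s s01] : exists2 s, 0 <= s <= 1 & root (- \det P) s.
  apply: poly_ivt => //; rewrite !hornerN !PE subr0 scale0r addr0 det1.
  by rewrite subrr raddf0 add0r scale1r oppr_cp0 ler01 oppr_ge0.
by rewrite rootN; apply/negP/nz.
Qed.

Section face_param.
Context {R : realType} {d : nat}.
Variable F : {fset 'rV[R]_d}.
Hypothesis Fi : aff_indep F.
Hypothesis F0 : F != fset0.
Local Notation m := (face_dim F).

Lemma size_vertices : size (enum_fset F) = m.+1.
Proof. by rewrite /face_dim prednK// cardfs_gt0. Qed.

(** Equality tests define the weight at every point, so it applies to elements of [F] and to the
    enumerated [vertex F i] alike. *)
Definition vertex_weight (a0 : R) (a : 'rV[R]_m) (v : 'rV[R]_d) : R :=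
  (v == vertex F 0)%:R * a0 + \sum_(i < m) (v == vertex F i.+1)%:R * a 0 i.

Lemma vertex_eq i j : (i < m.+1)%N -> (j < m.+1)%N ->
  (vertex F i == vertex F j) = (i == j).
Proof. by move=> im jm; rewrite /vertex nth_uniq ?size_vertices ?fset_uniq. Qed.

Lemma vertex_weight0 a0 a : vertex_weight a0 a (vertex F 0) = a0.
Proof.
rewrite /vertex_weight eqxx mul1r big1 ?addr0// => i _.
by rewrite vertex_eq ?ltnS ?ltn_ord// mul0r.
Qed.

Lemma vertex_weightS a0 a (i : 'I_m) : vertex_weight a0 a (vertex F i.+1) = a 0 i.
Proof.
rewrite /vertex_weight vertex_eq ?ltnS ?ltn_ord// mul0r add0r (bigD1 i)//=.
rewrite eqxx mul1r big1 ?addr0// => j ji.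
by rewrite vertex_eq ?ltnS ?ltn_ord// eqSS val_eqE eq_sym (negbTE ji) mul0r.
Qed.

Lemma sum_vertices (V : nmodType) (G : 'rV[R]_d -> V) :
  \sum_(x : F) G (val x) = G (vertex F 0) + \sum_(i < m) G (vertex F i.+1).
Proof.
rewrite -(big_seq_fsetE _ _ xpredT G) /= (big_nth 0) size_vertices big_mkord.
by rewrite big_ord_recl.
Qed.

Lemma sum_vertex_weight (V : lmodType R) a0 a (G : 'rV[R]_d -> V) :
  \sum_(x : F) vertex_weight a0 a (val x) *: G (val x) =
  a0 *: G (vertex F 0) + \sum_i a 0 i *: G (vertex F i.+1).
Proof.
rewrite (sum_vertices (fun v => vertex_weight a0 a v *: G v)) vertex_weight0.
by congr (_ + _); apply: eq_bigr => i _; rewrite vertex_weightS.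
Qed.

Lemma sum_vertex_weight1 a0 a :
  \sum_(x : F) vertex_weight a0 a (val x) = a0 + \sum_i a 0 i.
Proof.
rewrite (sum_vertices (vertex_weight a0 a)) vertex_weight0.
by congr (_ + _); apply: eq_bigr => i _; rewrite vertex_weightS.
Qed.

Lemma edge_mxE a : a *m edge_mx F =
  \sum_i a 0 i *: vertex F i.+1 - (\sum_i a 0 i) *: vertex F 0.
Proof.
rewrite mulmx_sum_row scaler_suml -sumrB; apply: eq_bigr => i _.
by rewrite rowK scalerBr.
Qed.

(** The quadratic form at a is the squared length of [a *m edge_mx F]; if that vector were 0, a and
    minus its sum would be an affine relation among the vertices. *)
Lemma gram_det_gt0 : 0 < \det (edge_mx F *m (edge_mx F)^T).
Proof.
apply: det_pos_def => a a0.
rewrite mulmxA -mulmxA -trmx_mul mxE.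
have [j aj] : exists j, (a *m edge_mx F) 0 j != 0.
  apply/rV0Pn; apply: contraNneq a0 => aE0; apply/eqP/rowP => i; rewrite mxE.
  pose c (x : F) := vertex_weight (- \sum_i a 0 i) a (val x).
  have ilt : vertex F i.+1 \in F.
    by rewrite /vertex -[_ \in F]/(_ \in enum_fset F) mem_nth// size_vertices ltnS.
  have : c [` ilt]%fset = 0.
    apply: Fi; first by rewrite sum_vertex_weight1 addNr.
    rewrite (sum_vertex_weight _ _ id) /= scaleNr addrC -[RHS]aE0 edge_mxE.
    by [].
  by rewrite /c /= vertex_weightS.
move: (a *m _) aj => w wj.
rewrite (bigD1 j)//= mxE -expr2 ltr_pwDl ?exprn_even_gt0 ?sumr_ge0// => l _.
by rewrite mxE -expr2 sqr_ge0.
Qed.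

Lemma bary_param a : bary F (vertex F 0 + a *m edge_mx F) =
  [ffun x => vertex_weight (1 - \sum_i a 0 i) a (val x)].
Proof.
apply: bary_uniq => //; under eq_bigr do rewrite ffunE.
  by rewrite sum_vertex_weight1 subrK.
by rewrite (sum_vertex_weight _ _ id) /= scalerBl scale1r edge_mxE addrA addrAC.
Qed.

Lemma polyfun_bary_param x :
  polyfun leq 0 (fun a : 'rV[R]_m => bary F (vertex F 0 + a *m edge_mx F) x).
Proof.
have pc (b : R) : polyfun leq 0 (fun _ : 'rV[R]_m => b) by exact: polyfun_cst.
have px i : polyfun leq 0 (fun a : 'rV[R]_m => a 0 i).
  by apply: (@polyfun_weaken _ _ leq _ 1) => //; exact: polyfun_coord.
have pm f g : polyfun leq 0 f -> polyfun leq 0 g ->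
    polyfun leq 0 (fun a : 'rV[R]_m => f a * g a).
  by move=> pf pg; apply: polyfunM pf pg.
refine (@eq_polyfun R m leq _
  (fun a : 'rV[R]_m => (val x == vertex F 0)%:R * (1 - \sum_i a 0 i) +
    \sum_(i < m) (val x == vertex F i.+1)%:R * a 0 i) _ _ _).
  by move=> a; rewrite bary_param ffunE.
apply: polyfunD; last by apply: polyfun_sum => i _; exact: polyfunZ.
by apply: polyfunZ; apply: polyfunB => //; apply: polyfun_sum.
Qed.

Lemma param_simplex (t : m.-tuple R) : unit_simplex t ->
  simplex F (vertex F 0 + row_of_tuple t *m edge_mx F).
Proof.
move=> [t0 t1].
have tE i : row_of_tuple t 0 i = tnth t i by rewrite mxE.
exists (fun x => vertex_weight (1 - \sum_i row_of_tuple t 0 i) (row_of_tuple t) (val x)).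
split; first last.
- by rewrite (sum_vertex_weight _ _ id) /= scalerBl scale1r edge_mxE addrA addrAC.
- by rewrite sum_vertex_weight1 subrK.
move=> x; apply: addr_ge0; last by apply: sumr_ge0 => i _; rewrite tE mulr_ge0.
rewrite mulr_ge0// subr_ge0; apply: le_trans t1.
by rewrite le_eqVlt; apply/orP; left; apply/eqP/eq_bigr.
Qed.

Lemma simplex_param y : simplex F y -> (forall x, 0 < bary F y x) ->
  exists2 t : m.-tuple R, (forall i, 0 < tnth t i) /\ \sum_i tnth t i < 1 &
    y = vertex F 0 + row_of_tuple t *m edge_mx F.
Proof.
move=> /(simplex_bary Fi)[_ l1 ly] l0.
have vF i : (i < m.+1)%N -> vertex F i \in F.
  by move=> im; rewrite -[_ \in F]/(_ \in enum_fset F) mem_nth// size_vertices.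
pose L v : R := if insub v is Some x then bary F y x else 0.
have LE (x : F) : L (val x) = bary F y x by rewrite /L valK.
have L0 i : (i < m.+1)%N -> 0 < L (vertex F i).
  by move=> im; rewrite -[vertex F i]/(val [` vF i im]%fset) LE.
exists [tuple L (vertex F i.+1) | i < m].
  split=> [i|]; first by rewrite tnth_mktuple L0// ltnS.
  rewrite -[ltRHS]l1; under [ltRHS]eq_bigr do rewrite -LE.
  rewrite (sum_vertices L); under eq_bigr do rewrite tnth_mktuple.
  by rewrite ltrDr L0.
rewrite edge_mxE -{1}ly; under eq_bigr do rewrite -LE.
rewrite (sum_vertices (fun v => L v *: v)).
have -> : L (vertex F 0) = 1 - \sum_(i < m) L (vertex F i.+1).
  rewrite -l1; under eq_bigr do rewrite -LE.
  by rewrite (sum_vertices L) addrK.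
rewrite scalerBl scale1r -addrA [- _ + _]addrC; congr (_ + (_ - _ *: _));
  by apply: eq_bigr => i _; rewrite mxE tnth_mktuple.
Qed.

End face_param.

Section face_pairing.
Context {R : realType} {d : nat}.
Variable F : {fset 'rV[R]_d}.
Hypothesis Fi : aff_indep F.
Hypothesis F0 : F != fset0.
Implicit Types f g v : 'rV[R]_d -> R.
Local Notation param t := (vertex F 0 + row_of_tuple t *m edge_mx F).

(** Bubbles are cut off outside F, hence not polynomial on the whole space; their pullbacks to the
    unit simplex are, which is all that integration needs. *)
Definition face_poly f : Prop :=
  exists2 h : 'rV[R]_(face_dim F) -> R, polyfun leq 0 h &
    forall t : (face_dim F).-tuple R, unit_simplex t -> f (param t) = h (row_of_tuple t).

Lemma face_polyM f g : face_poly f -> face_poly g -> face_poly (f \* g).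
Proof.
move=> [h ph fh] [h' ph' gh']; exists (fun x => h x * h' x).
  exact: polyfunM ph ph'.
by move=> t tS /=; rewrite fh ?gh'.
Qed.

Lemma face_poly_sum (I : Type) (s : seq I) (P : pred I) (c : I -> R)
    (f : I -> 'rV[R]_d -> R) : (forall i, P i -> face_poly (f i)) ->
  face_poly (fun y => \sum_(i <- s | P i) c i * f i y).
Proof.
move=> pf; elim: s => [|i s [h ph hE]].
  by exists (fun=> 0); [exact: polyfun0|move=> t _; rewrite big_nil].
case Pi: (P i); last by exists h => // t tS; rewrite big_cons Pi hE.
have [h' ph' hE'] := pf i Pi.
exists (fun x => c i * h' x + h x).
  by apply: polyfunD => //; exact: polyfunZ.
by move=> t tS; rewrite big_cons Pi hE ?hE'.
Qed.

Lemma face_poly_bern k (al : {ffun F -> 'I_k.+1}) : face_poly (bern al).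
Proof.
exists (fun a => \prod_x bary F (vertex F 0 + a *m edge_mx F) x ^+ al x) => //.
have H : polyfun leq (\sum_(x : F) (al x * 0))%N
    (fun a => \prod_x bary F (vertex F 0 + a *m edge_mx F) x ^+ al x).
  apply: polyfun_prod => [|x _]; first exact: additive_leq.
  apply: polyfunX; first exact: additive_leq.
  exact: polyfun_bary_param.
exact: (polyfun_weaken _ H).
Qed.

Lemma face_poly_ext f g : (forall y, simplex F y -> f y = g y) ->
  face_poly f -> face_poly g.
Proof.
move=> fg [h ph fh]; exists h => // t tS; rewrite -fg ?fh//.
exact: param_simplex.
Qed.

Lemma face_poly_bubble r k n v : bubble r k F n v -> face_poly v.
Proof.
rewrite bubbleE => -[N [c [e [ee ->]]]].
have -> : \sum_i c i *: e i = (fun y => \sum_i c i * e i y).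
  by apply/funext => y; rewrite fun_sumE.
apply: face_poly_sum => i _; have [al _ <-] := ee i.
apply: face_poly_ext (face_poly_bern al) => y yF.
by rewrite patchE mem_set.
Qed.

Lemma face_poly_polyfun rho n f : polyfun rho n f -> face_poly f.
Proof.
move=> [I [c [a [_ ->]]]]; apply: face_poly_sum => i _.
exists (fun b => mono (a i) (vertex F 0 + b *m edge_mx F)) => //.
have H : polyfun leq (\sum_j (a i j * 0))%N (fun b : 'rV[R]_(face_dim F) =>
    \prod_j (vertex F 0 + b *m edge_mx F) 0 j ^+ a i j).
  apply: polyfun_prod => [|j _]; first exact: additive_leq.
  apply: polyfunX; first exact: additive_leq.
  refine (@eq_polyfun _ _ leq _ (fun b : 'rV[R]_(face_dim F) =>
    (vertex F 0) 0 j + \sum_l b 0 l * (edge_mx F) l j) _ _ _).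
    by move=> b; rewrite !mxE.
  apply: polyfunD; first exact: polyfun_cst.
  by apply: (@polyfun_weaken _ _ leq _ 1) => //; exact: polyfun_linear.
exact: (polyfun_weaken _ H).
Qed.

Lemma face_integralE f (h : 'rV[R]_(face_dim F) -> R) :
  (forall t : (face_dim F).-tuple R, unit_simplex t -> f (param t) = h (row_of_tuple t)) ->
  face_integral F f = Num.sqrt (\det (edge_mx F *m (edge_mx F)^T)) *
    \int[lebesgue_tuple (face_dim F)]_(t in @unit_simplex R (face_dim F)) h (row_of_tuple t).
Proof.
by move=> fh; congr (_ * _); apply: eq_Rintegral => t /set_mem; exact: fh.
Qed.

Lemma face_pairingB f g v : face_poly f -> face_poly g -> face_poly v ->
  face_pairing F (fun y => f y - g y) v = face_pairing F f v - face_pairing F g v.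
Proof.
move=> pf pg pv; rewrite /face_pairing; case: ifP => _; first by rewrite mulrBl.
have [h ph hE] := face_polyM pf pv; have [h' ph' hE'] := face_polyM pg pv.
rewrite -mulrBr (face_integralE hE) (face_integralE hE').
rewrite (@face_integralE ((fun y => f y - g y) \* v)
  (fun x => h x - h' x)) => [|t tS]; last first.
  by rewrite -hE// -hE'//= mulrBl.
rewrite -mulrBr RintegralB//; first exact: measurable_unit_simplex.
- exact: integrable_polyfun ph.
- exact: integrable_polyfun ph'.
Qed.

Lemma face_integral1_neq0 : face_integral F (cst 1) != 0.
Proof.
rewrite (@face_integralE _ (cst 1))// mulf_neq0//.
  by rewrite gt_eqF// sqrtr_gt0 gram_det_gt0.
apply/eqP => int0.
(* The point with all coordinates b is the barycentre of the unit simplex, hence interior. *)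
pose b : R := (face_dim F).+1%:R^-1.
have b0 : 0 < b by rewrite invr_gt0 ltr0n.
have /eqP : cst (1 : R) (row_of_tuple [tuple b | i < face_dim F]) = 0.
  apply: (@Rintegral_sqr_eq0 _ _ (cst 1)).
  - exact: polyfun_cst.
  - by apply: etrans int0; apply: eq_Rintegral => t _; rewrite expr1n.
  - by move=> i; rewrite tnth_mktuple.
  under eq_bigr do rewrite tnth_mktuple.
  rewrite sumr_const card_ord -mulr_natl ltr_pdivrMr ?ltr0n// mul1r.
  by rewrite ltr_nat.
by rewrite oner_eq0.
Qed.

(** On F this pairs f with itself. Two functions occur because a normal derivative is defined
    everywhere, whereas a test function is zero off F. *)
Lemma face_pairing_definite f v : face_poly f ->
  (forall y, simplex F y -> v y = f y) -> face_pairing F f v = 0 ->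
  forall y, simplex F y -> (forall x, 0 < bary F y x) -> f y = 0.
Proof.
move=> pf vf; rewrite /face_pairing; case: ifPn => [/eqP F1 fv0 y yF y0|_].
  have [t _ ->] := simplex_param Fi F0 yF y0.
  have v0F : simplex F (vertex F 0).
    have tS : unit_simplex ([tuple 0 | i < face_dim F] : _.-tuple R).
      by split=> [i|]; rewrite ?tnth_mktuple// big1// => i _; rewrite tnth_mktuple.
    have := param_simplex F0 tS; congr (simplex F _).
    rewrite (_ : row_of_tuple _ = 0) ?mul0mx ?addr0//.
    by apply/rowP => i; rewrite !mxE tnth_mktuple.
  have -> : row_of_tuple t *m edge_mx F = 0.
    apply/rowP => j; rewrite !mxE big1// => i _.
    by case: i => i /= lt; exfalso; move: lt; rewrite /face_dim F1.
  by move/eqP: fv0; rewrite addr0 vf// mulf_eq0 orbb => /eqP.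
move=> /eqP; rewrite mulf_eq0 invr_eq0 (negbTE face_integral1_neq0) /=.
have [h ph hE] := pf.
rewrite (@face_integralE (f \* v) (fun x => h x ^+ 2)) => [|t tS]; last first.
  by rewrite /= vf ?hE// -?expr2//; exact: param_simplex.
rewrite mulf_eq0 gt_eqF ?sqrtr_gt0 ?gram_det_gt0//= => /eqP int0.
move=> y yF y0; have [t [t0 t1] ->] := simplex_param Fi F0 yF y0.
rewrite hE; last by split=> [i|]; exact: ltW.
exact: Rintegral_sqr_eq0 ph int0 _ t0 t1.
Qed.

End face_pairing.

(** * Normal derivatives on a face *)

Section normal_derive_linear.
Context {R : realType} {m : nat}.
Implicit Types f g : 'rV[R]_m -> R.

Lemma normal_derive_polyfunD (theta : 'I_m -> nat) rho n rho' n' f g x :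
  polyfun rho n f -> polyfun rho' n' g ->
  normal_derive 1%:M theta (fun y => f y + g y) x =
  normal_derive 1%:M theta f x + normal_derive 1%:M theta g x.
Proof.
move=> [I [c [a [_ ->]]]] [J [c' [a' [_ ->]]]].
have -> : (fun y : 'rV[R]_m => \sum_i c i * mono (a i) y + \sum_i c' i * mono (a' i) y) =
  (fun y => \sum_ij (match ij with inl i => c i | inr j => c' j end) *
    mono (match ij with inl i => a i | inr j => a' j end) y).
  by apply/funext => y; rewrite big_sumType.
by rewrite !normal_derive_mono_sum big_sumType.
Qed.

Lemma normal_derive_polyfunZ (theta : 'I_m -> nat) rho n b f x : polyfun rho n f ->
  normal_derive 1%:M theta (fun y => b * f y) x = b * normal_derive 1%:M theta f x.
Proof.
move=> [I [c [a [_ ->]]]].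
have -> : (fun y : 'rV[R]_m => b * (\sum_i c i * mono (a i) y)) =
    (fun y => \sum_i (b * c i) * mono (a i) y).
  by apply/funext => y; rewrite mulr_sumr; apply: eq_bigr => i _; rewrite mulrA.
rewrite !normal_derive_mono_sum mulr_sumr; apply: eq_bigr => i _.
by rewrite !mulrA.
Qed.

Lemma normal_derive_polyfun_sum (theta : 'I_m -> nat) rho n (I : Type) (s : seq I)
    (c : I -> R) (f : I -> 'rV[R]_m -> R) x :
  (forall i, polyfun rho n (f i)) ->
  normal_derive 1%:M theta (fun y => \sum_(i <- s) c i * f i y) x =
  \sum_(i <- s) c i * normal_derive 1%:M theta (f i) x.
Proof.
move=> pf; elim: s => [|i s IH].
  rewrite (_ : (fun y => _) = (fun y => 0 * (fun=> 0) y)); last first.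
    by apply/funext => y; rewrite big_nil mul0r.
  by rewrite (normal_derive_polyfunZ _ _ _ (polyfun0 eq_op 0%N)) mul0r big_nil.
rewrite (_ : (fun y => _) = (fun y => c i * f i y + \sum_(j <- s) c j * f j y)); last first.
  by apply/funext => y; rewrite big_cons.
have pi : polyfun rho n (fun y => c i * f i y) by exact: polyfunZ.
have ps : polyfun rho n (fun y => \sum_(j <- s) c j * f j y).
  by apply: polyfun_sum => j _; exact: polyfunZ.
by rewrite (normal_derive_polyfunD _ _ pi ps) IH big_cons (normal_derive_polyfunZ _ _ _ (pf i)).
Qed.

End normal_derive_linear.

Section face_derivative.
Context {R : realType} {d : nat}.
Variables (K F : {fset 'rV[R]_d}) (k : nat).
Hypothesis Kn : nondegenerate_simplex K.
Hypothesis FK : (F `<=` K)%fset.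
Hypothesis F0 : F != fset0.
Variable N : 'M[R]_(codim F, d).
Hypothesis NF : is_normal_frame N.
Let Ki : aff_indep K := Kn.2.
Implicit Types al : {ffun K -> 'I_k.+1}.

Definition normal_degree al : nat := (\sum_(x : K | val x \notin F) al x)%N.

(** For x outside F and any y on F, this is the barycentric coordinate at x of y + t N, since that
    of y is 0. *)
Definition normal_form (x : K) (t : 'rV[R]_(codim F)) : R :=
  \sum_j t 0 j * bary_lin (row j N) x.

Definition normal_part al (t : 'rV[R]_(codim F)) : R :=
  \prod_(x : K | val x \notin F) normal_form x t ^+ al x.

Definition restrict al : {ffun F -> 'I_k.+1} := [ffun x => al (fincl FK x)].

Lemma card_outside : #|[pred x : K | val x \notin F]| = codim F.
Proof.
have -> : #|[pred x : K | val x \notin F]| = #|finset.setC (fsub K F)|.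
  by apply: eq_card => x; rewrite finset.in_setC in_fsub !inE.
by rewrite cardsCs finset.setCK (card_fsub FK) -cardfE Kn.1.
Qed.

Lemma vertex_simplex (x : F) : simplex F (val x).
Proof.
exists (fun z => (z == x)%:R); split => [z||].
- exact: ler0n.
- by rewrite (bigD1 x)//= eqxx big1 ?addr0// => z /negbTE ->.
- rewrite (bigD1 x)//= eqxx scale1r big1 ?addr0// => z /negbTE ->.
  by rewrite scale0r.
Qed.

(** If the outside coordinates of y + t N vanish, t N is a combination of differences of vertices of
    F, which [N^T] annihilates; [N *m N^T = 1%:M] then gives t = 0. *)
Lemma normal_form_inj t : (forall x : K, val x \notin F -> normal_form x t = 0) -> t = 0.
Proof.
move=> t0; have [x0 x0F] := fset0Pn _ F0.
pose y : 'rV[R]_d := val [` x0F]%fset.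
have [_ yC] := bary_simplex_face FK Ki (vertex_simplex [` x0F]%fset).
have tC (x : K) : val x \notin F -> bary K (y + t *m N) x = 0.
  by move=> xF; rewrite bary_frame// [X in X + _]yC// add0r; exact: t0.
have [b1 by_] := bary_total Kn (y + t *m N).
pose b (x : K) := bary K (y + t *m N) x.
have tN : t *m N = \sum_(x : K | val x \in F) b x *: (val x - y).
  under eq_bigr do rewrite scalerBr; rewrite sumrB -scaler_suml.
  apply/eqP; rewrite eq_sym subr_eq addrC; apply/eqP.
  rewrite (bigID (fun x : K => val x \in F)) /= [X in _ + X]big1 ?addr0 in by_; last first.
    by move=> x xF; rewrite tC// scale0r.
  rewrite (bigID (fun x : K => val x \in F)) /= [X in _ + X]big1 ?addr0 in b1; last first.
    by move=> x xF; rewrite tC.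
  by rewrite by_ b1 scale1r.
have : t *m N *m N^T = 0.
  rewrite tN mulmx_suml big1// => x xF; rewrite -scalemxAl.
  by rewrite NF.2// scaler0.
by rewrite -mulmxA NF.1 mulmx1.
Qed.

(** There are [codim F] outside vertices and as many normal directions, so injectivity gives
    surjectivity. *)
Lemma normal_form_surj (l : K -> R) :
  exists t, forall x : K, val x \notin F -> normal_form x t = l x.
Proof.
pose C := [pred x : K | val x \notin F].
pose P : 'M[R]_(codim F, #|C|) := \matrix_(j, i) bary_lin (row j N) (enum_val i).
have PE t i : (t *m P) 0 i = normal_form (enum_val i) t.
  by rewrite mxE; apply: eq_bigr => j _; rewrite mxE.
have out x : val x \notin F -> exists i : 'I_#|C|, x = enum_val i.
  by move=> xC; exists (enum_rank_in (xC : x \in C) x); rewrite enum_rankK_in.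
have Pfree : row_free P.
  rewrite -kermx_eq0; apply/eqP/row_matrixP => i; rewrite row0.
  have /sub_kermxP : (row i (kermx P) <= kermx P)%MS by exact: row_sub.
  move: (row i _) => t tP; apply: normal_form_inj => x /out[j ->].
  by rewrite -PE tP mxE.
have Pfull : row_full P by rewrite /row_full (eqP Pfree) card_outside.
have [t tE] : exists t, \row_i l (enum_val i) = t *m P by apply/submxP/submx_full.
by exists t => x /out[i ->]; rewrite -PE -tE mxE.
Qed.

Lemma polyfun_normal_part al : polyfun eq_op (normal_degree al) (normal_part al).
Proof.
have := @polyfun_prod R _ eq_op K (index_enum _) (fun x => val x \notin F)
  (fun x => (al x * 1)%N) (fun x t => normal_form x t ^+ al x) additive_eq.
under eq_bigr do rewrite muln1.
apply => x _; apply: polyfunX; first exact: additive_eq.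
exact: polyfun_linear.
Qed.

(** The outside factor is exactly [normal_part]; only the inside factor is frozen at t = 0. The term
    [0 *m N] keeps the error in the form A t - A 0 for [polyfun_sub0]. *)
Lemma bern_split al y t : simplex F y -> bern al (y + t *m N) =
  bern (restrict al) y * normal_part al t +
  (\prod_(x : F) bary K (y + t *m N) (fincl FK x) ^+ al (fincl FK x) -
   \prod_(x : F) bary K (y + 0 *m N) (fincl FK x) ^+ al (fincl FK x)) * normal_part al t.
Proof.
move=> yF; have [bF bC] := bary_simplex_face FK Ki yF.
rewrite mul0mx addr0.
have -> : \prod_(x : F) bary K y (fincl FK x) ^+ al (fincl FK x) = bern (restrict al) y.
  by apply: eq_bigr => x _; rewrite bF ffunE.
rewrite -mulrDl [X in _ = X * _]addrC subrK /bern (bigID (fun x : K => val x \in F)) /=.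
rewrite (big_face _ FK); congr (_ * _); apply: eq_bigr => x xF.
by rewrite bary_frame// bC// add0r.
Qed.

(** Each outside coordinate vanishes at y, whatever the directions. The matrix M is arbitrary
    because gluing needs the order in all directions, with M the identity. *)
Lemma polyfun_bern_frame s (M : 'M[R]_(s, d)) al y : simplex F y ->
  polyfun leq (normal_degree al) (fun t : 'rV[R]_s => bern al (y + t *m M)).
Proof.
move=> yF; have [bF bC] := bary_simplex_face FK Ki yF.
have H0 : polyfun leq 0 (fun t : 'rV[R]_s =>
    \prod_(x : K | val x \in F) bary K (y + t *m M) x ^+ al x).
  have H : polyfun leq (\sum_(x : K | val x \in F) (al x * 0))%N
      (fun t : 'rV[R]_s =>
       \prod_(x : K | val x \in F) bary K (y + t *m M) x ^+ al x).
    apply: polyfun_prod => [|x _]; first exact: additive_leq.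
    by apply: polyfunX; [exact: additive_leq|exact: polyfun_bary_frame].
  exact: polyfun_weaken H.
have H1 : polyfun leq (\sum_(x : K | val x \notin F) (al x * 1))%N
    (fun t : 'rV[R]_s =>
      \prod_(x : K | val x \notin F) bary K (y + t *m M) x ^+ al x).
  apply: polyfun_prod => [|x xF]; first exact: additive_leq.
  apply: polyfunX; first exact: additive_leq.
  by apply: polyfun_bary_frame1 => //; exact: bC.
apply: (@eq_polyfun _ _ _ _ (fun t : 'rV[R]_s =>
   (\prod_(x : K | val x \in F) bary K (y + t *m M) x ^+ al x) *
   (\prod_(x : K | val x \notin F) bary K (y + t *m M) x ^+ al x))).
  by move=> t; rewrite /bern [RHS](bigID (fun x : K => val x \in F)).
apply: (polyfunM _ H0 H1) => p q _; under eq_bigr do rewrite muln1.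
by move=> le; rewrite (leq_trans le)// leq_addl.
Qed.

(** The remainder of [bern_split] has order [normal_degree + 1] in t, too high for [theta] to detect
    at 0. *)
Lemma normal_derive_bern al y (theta : 'I_(codim F) -> nat) : simplex F y ->
  (\sum_j theta j <= normal_degree al)%N ->
  normal_derive N theta (bern al) y =
  bern (restrict al) y * normal_derive 1%:M theta (normal_part al) 0.
Proof.
move=> yF le; rewrite -[y in LHS]addr0 -[X in _ + X](mul0mx _ N) normal_derive_frame.
under eq_fun do rewrite bern_split//.
set A := fun t : 'rV[R]_(codim F) =>
  \prod_(x : F) bary K (y + t *m N) (fincl FK x) ^+ al (fincl FK x).
have pA : polyfun leq 0 A.
  have H : polyfun leq (\sum_(x : F) (al (fincl FK x) * 0))%N A.
    apply: polyfun_prod => [|x _]; first exact: additive_leq.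
    by apply: polyfunX; [exact: additive_leq|exact: polyfun_bary_frame].
  exact: polyfun_weaken H.
have pB := polyfun_normal_part al.
have pAB : polyfun leq (normal_degree al).+1 (fun t => (A t - A 0) * normal_part al t).
  apply: polyfunM (polyfun_sub0 pA) pB => p q p1 /eqP ->.
  by rewrite -add1n leq_add2r.
rewrite (normal_derive_polyfunD _ _ (polyfunZ _ pB) pAB).
rewrite (normal_derive_polyfunZ _ _ _ pB).
by rewrite (polyfun_normal_derive0 pAB) ?addr0.
Qed.

End face_derivative.

(** * Vanishing degrees of freedom *)

Section face_step.
Context {R : realType} {d : nat}.
Variables (K F : {fset 'rV[R]_d}) (k : nat) (r : nat -> nat).
Hypothesis Kn : nondegenerate_simplex K.
Hypothesis FK : (F `<=` K)%fset.
Hypothesis F0 : F != fset0.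
Variable N : 'M[R]_(codim F, d).
Hypothesis NF : is_normal_frame N.
Let Ki : aff_indep K := Kn.2.
Let Fi : aff_indep F := aff_indep_sub FK Ki.
Variables (n : nat) (c : {ffun K -> 'I_k.+1} -> R).
Hypothesis c_deg : forall al, c al != 0 -> (\sum_x al x = k)%N.
Hypothesis c_n : forall al, c al != 0 -> (n <= normal_degree F al)%N.
Hypothesis c_bubble : forall al, c al != 0 -> normal_degree F al = n ->
  bubble_index (k - n)%N (fun l => r (codim F + l) - n)%N (restrict FK al).
Let u y := \sum_al c al * bern al y.

Lemma normal_derive_bernstein (theta : 'I_(codim F) -> nat) y :
  (\sum_j theta j)%N = n -> simplex F y ->
  normal_derive N theta u y = \sum_al c al *
    (bern (restrict FK al) y * normal_derive 1%:M theta (normal_part N al) 0).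
Proof.
move=> thn yF; rewrite -[y in LHS]addr0 -[X in _ + X](mul0mx _ N) normal_derive_frame.
have pb (al : {ffun K -> 'I_k.+1}) : polyfun leq 0 (fun t => bern al (y + t *m N)).
  exact: polyfun_weaken (polyfun_bern_frame Kn FK N al yF).
rewrite /u (normal_derive_polyfun_sum _ _ _ _ pb); apply: eq_bigr => al _.
have [->|cal] := eqVneq (c al) 0; first by rewrite !mul0r.
congr (_ * _); rewrite -normal_derive_frame mul0mx addr0 normal_derive_bern//.
by rewrite thn c_n.
Qed.

Lemma normal_derive_part_gt (al : {ffun K -> 'I_k.+1}) (theta : 'I_(codim F) -> nat) :
  (\sum_j theta j < normal_degree F al)%N ->
  normal_derive 1%:M theta (normal_part N al) 0 = 0.
Proof.
apply: polyfun_normal_derive0; apply: polyfun_weaken (polyfun_normal_part N al).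
by move=> p /eqP ->.
Qed.

Lemma normal_derive_bubble (theta : 'I_(codim F) -> nat) :
  (\sum_j theta j)%N = n -> exists2 v, bubble r k F n v &
    forall y, simplex F y -> v y = normal_derive N theta u y.
Proof.
move=> thn.
exists (\sum_(al | (c al != 0) && (normal_degree F al == n))
  (c al * normal_derive 1%:M theta (normal_part N al) 0) *:
    ((bern (restrict FK al)) \_ (simplex F))).
  rewrite bubbleE; apply: lspan_bigsum => al /andP[cal /eqP aln].
  by exists (restrict FK al) => //; exact: c_bubble.
move=> y yF; rewrite fun_sumE normal_derive_bernstein// big_mkcond.
apply: eq_bigr => al _; rewrite patchE mem_set//.
have [->|cal] /= := eqVneq (c al) 0; first by rewrite mul0r.
case: eqVneq => [_|aln]; first by rewrite -mulrA [X in _ * X]mulrC.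
rewrite normal_derive_part_gt ?mulr0// thn ltn_neqAle eq_sym aln.
exact: c_n.
Qed.

Hypothesis dof0 : forall theta : 'I_(codim F) -> nat, (\sum_j theta j)%N = n ->
  forall v, bubble r k F n v -> face_pairing F (normal_derive N theta u) v = 0.

(* [D^theta u] restricted to [F] is a bubble function, hence a test function. *)
Lemma face_step al : c al != 0 -> (n < normal_degree F al)%N.
Proof.
pose c' (al : {ffun K -> 'I_k.+1}) := if normal_degree F al == n then c al else 0.
suff c'0 al' : c' al' = 0.
  move=> cal; rewrite ltn_neqAle c_n// andbT eq_sym.
  by apply: contraNneq cal => aln; rewrite -(c'0 al) /c' aln eqxx.
(* Only the variables on F are rescaled: there l becomes a point y of F, while its values off F stay
   arbitrary and are realised by a normal vector t. *)
move: al'; apply: (@homogeneous_free _ _ _ [pred x : K | val x \in F] (k - n)%N).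
- have [x xF] := fset0Pn _ F0.
  by exists (fincl FK [` xF]%fset); rewrite inE.
- move=> al'; rewrite /c'; case: ifPn => [/eqP aln cal|_]; last by rewrite eqxx.
  have := c_deg cal; rewrite (bigID (fun x : K => val x \in F)) /=.
  by rewrite -/(normal_degree F al') aln => e; exact: (canRL (addnK n) e).
move=> l l0 l1.
pose lF : {ffun F -> R} := [ffun x => l (fincl FK x)].
have lF1 : \sum_x lF x = 1.
  by rewrite -[RHS]l1 (big_face _ FK); apply: eq_bigr => x _; rewrite ffunE.
pose y := \sum_x lF x *: val x.
have bE : bary F y = lF by exact: bary_comb.
have yF : simplex F y by exists lF; split=> // x; rewrite ffunE ltW.
have y0 x : 0 < bary F y x by rewrite bE ffunE.
have [t tE] := normal_form_surj Kn FK F0 NF l.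
(* For fixed y, [G] is homogeneous of degree n in t, and its derivatives of order n at 0 are the
   values of D^theta u at y. *)
pose G t := \sum_al (c' al * bern (restrict FK al) y) * normal_part N al t.
have -> : \sum_al' c' al' * \prod_i l i ^+ al' i = G t.
  apply: eq_bigr => al' _; rewrite -mulrA; congr (_ * _).
  rewrite (bigID (fun x : K => val x \in F)) /= (big_face _ FK); congr (_ * _).
    by apply: eq_bigr => x _; rewrite bE !ffunE.
  by apply: eq_bigr => x xF; rewrite tE.
apply: (@polyfun_normal_derive_eq0 _ _ n).
  apply: polyfun_sum => al' _; rewrite /c'; case: eqP => [<-|_].
    by apply: polyfunZ; exact: polyfun_normal_part.
  by apply: eq_polyfun (polyfun0 _ _) => t'; rewrite !mul0r.
move=> theta thn.
have pn (al' : {ffun K -> 'I_k.+1}) : polyfun leq 0 (normal_part N al').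
  exact: polyfun_weaken (polyfun_normal_part N al').
rewrite (normal_derive_polyfun_sum _ _ _ _ pn).
have [v vb vE] := normal_derive_bubble thn.
have pf : face_poly F (normal_derive N theta u).
  by apply: face_poly_ext (face_poly_bubble Fi F0 vb).
have := face_pairing_definite Fi F0 pf vE (dof0 thn vb) yF y0.
rewrite normal_derive_bernstein//; apply: etrans; apply: eq_bigr => al' _.
rewrite mulrA /c'; case: eqVneq => // aln.
have [->|cal] := eqVneq (c al') 0; first by rewrite !mul0r.
rewrite normal_derive_part_gt ?mulr0// thn ltn_neqAle eq_sym aln.
exact: c_n.
Qed.

End face_step.

Section face_induction.
Context {R : realType} {d : nat}.
Variables (r : nat -> nat) (k : nat) (K : {fset 'rV[R]_d}).
Hypothesis r_growth : forall i, (1 <= i < d)%N ->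
  (2 ^ (d - i) * r i <= 2 ^ (d - i.+1) * r i.+1)%N.
Hypothesis k_large : (2 * r d + 1 <= k)%N.
Hypothesis Kn : nondegenerate_simplex K.
Variable nu : forall F : {fset 'rV[R]_d}, 'M[R]_(codim F, d).
Hypothesis nuK : forall F, subsimplex F K -> is_normal_frame (nu F).
Variable c : {ffun K -> 'I_k.+1} -> R.
Hypothesis c_deg : forall al, c al != 0 -> (\sum_x al x = k)%N.
Let u y := \sum_al c al * bern al y.

(** [E] is [K] for unisolvence and a common face for gluing: the degrees of freedom vanish on faces
    of [E] only, while the coefficients are those on [K]. *)
Lemma face_induction (E : {fset 'rV[R]_d}) : (E `<=` K)%fset ->
  (forall F, subsimplex F E -> forall n (theta : 'I_(codim F) -> nat) v,
     (n <= max_order r (codim F))%N -> (\sum_j theta j)%N = n ->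
     bubble r k F n v -> dof nu theta u v = 0) ->
  forall F, subsimplex F E -> forall al, c al != 0 ->
    (max_order r (codim F) < normal_degree F al)%N.
Proof.
move=> EK dof0 F; move: {2}(#|` F|) (leqnn #|` F|) => b.
elim: b F => [|b IH] F Fb [FE F0].
  by move: F0; rewrite -cardfs_gt0; case: #|` F| Fb.
have FK := fsubset_trans FE EK.
have card_K : #|{: K}| = d.+1 by rewrite -cardfE Kn.1.
have fincl_setT : imset (fincl FK) (mem (finset.setTfor F)) = fsub K F.
  by rewrite (fsubE FK); apply/finset.setP => x;
    apply/imsetP/imsetP => -[y _ ->]; exists y; rewrite ?inE.
have codimE G : (G `<=` K)%fset -> codim G = #|finset.setC (fsub K G)|.
  by move=> GK; rewrite /codim -card_K -(card_fsub GK) [RHS]cardsCs finset.setCK.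
have degE (G : {fset 'rV[R]_d}) (al : {ffun K -> 'I_k.+1}) :
    normal_degree G al = (\sum_(x in finset.setC (fsub K G)) al x)%N.
  by apply: eq_bigl => x; rewrite finset.in_setC in_fsub.
(* n runs one past the last order, where the bound is the claim. *)
have step n : (n <= (max_order r (codim F)).+1)%N ->
    forall al, c al != 0 -> (n <= normal_degree F al)%N.
  elim: n => [//|n IHn] nr; have {}IHn := IHn (ltnW nr); rewrite ltnS in nr.
  apply: (face_step (r := r) Kn F0 (nuK (conj FK F0)) c_deg IHn) => [al cal aln|theta thn v vb].
    have D0 : fsub K F != finset.set0 by rewrite fsub_eq0.
    have := @bubble_index_restrict _ _ _ r_growth k_large _ _ (fincl FK) n
      (@fincl_inj _ _ _ FK) card_K.
    rewrite fincl_setT -codimE// => /(_ D0 nr al).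
    rewrite -degE aln => /(_ erefl) ->; rewrite c_deg// eqxx /=.
    rewrite /face_cond D0 -degE -codimE// aln nr /=.
    apply/forallP => J; apply/implyP => JF; apply/implyP => J0; apply/implyP => JnF.
    (* Enlarging the complement of F by J means passing to the smaller face F' = F minus J. The
       induction hypothesis on F' is the strict inequality that [face_cond] asks for J. *)
    pose D' : {set K} := finset.setD (fsub K F) J.
    pose F' : {fset 'rV[R]_d} := [fset val x | x in D']%fset.
    have F'K : (F' `<=` K)%fset by apply/fsubsetP => x /imfsetP[z _ ->]; exact: fsvalP.
    have F'D : fsub K F' = D' by rewrite FSetK.
    have F'F : (F' `<=` F)%fset.
      rewrite -(subset_fsubE F'K FK) F'D; exact: finset.subsetDl.
    have F'0 : F' != fset0.
      rewrite -(fsub_eq0 F'K) F'D; apply: contraNneq JnF => /eqP.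
      by rewrite finset.setD_eq0 finset.eqEsubset JF => ->.
    have D'C : finset.setC D' = finset.setU (finset.setC (fsub K F)) J.
      by rewrite /D' finset.setDE finset.setCI finset.setCK.
    have CJ : finset.setI (finset.setC (fsub K F)) J = finset.set0.
      apply/finset.setP => x; rewrite !inE; apply/negP => /andP[xF xJ].
      by have := fintype.subsetP JF x xJ; rewrite inE (negbTE xF).
    have cC : codim F' = (codim F + #|J|)%N.
      by rewrite !codimE// F'D D'C finset.cardsU CJ cards0 subn0.
    have F'b : (#|` F'| <= b)%N.
      have : (#|` F'| < #|` F|)%N.
        rewrite -(card_fsub F'K) -(card_fsub FK) F'D; apply: proper_card.
        rewrite properE finset.subsetDl; apply: contraNN J0 => sub.
        apply/eqP/finset.setP => x; rewrite inE; apply/negP => xJ.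
        by have := fintype.subsetP sub x (fintype.subsetP JF x xJ); rewrite inE xJ.
      by move=> lt; rewrite -ltnS (leq_trans lt).
    have := IH F' F'b (conj (fsubset_trans F'F FE) F'0) al cal.
    rewrite degE F'D D'C sum_setU_disjoint; last first.
      by rewrite -finset.setI_eq0 CJ.
    rewrite -degE aln cC; move: J0; rewrite -card_gt0; case: #|J| => // j _.
    by rewrite addnS.
  exact: dof0 nr thn vb.
exact: step.
Qed.

End face_induction.

(** * Gluing *)

(** The index i may jump with x; finiteness of S lets all the [g i] be close to l at once. It serves
    both for values and for difference quotients of the glued function. *)
Lemma cvg_finite_select {R : realType} (T : Type) (I : choiceType) (G : set_system T)
    (S : set I) (g : I -> T -> R) (f : T -> R) (l : R) :
  Filter G -> finite_set S -> (forall i, S i -> g i x @[x --> G] --> l) ->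
  (\forall x \near G, exists2 i, S i & f x = g i x) -> f x @[x --> G] --> l.
Proof.
move=> FG /finite_fsetP[X SX] gl fg.
apply/cvgrPdist_lt => e e0.
have H : G (\bigcap_(i in [set` X]) [set x | `|l - g i x| < e]).
  apply: filter_bigI => i iX.
  by have /cvgrPdist_lt/(_ e e0) : g i x @[x --> G] --> l by apply: gl; rewrite SX.
near=> x.
have [i Si ->] : exists2 i, S i & f x = g i x by near: x.
have : (\bigcap_(i in [set` X]) [set x | `|l - g i x| < e]) x by near: x.
by apply; rewrite -SX.
Unshelve. all: by end_near. Qed.

Section simplex_topology.
Context {R : realType} {d : nat}.

Lemma simplex_baryE (K : {fset 'rV[R]_d}) y : nondegenerate_simplex K ->
  simplex K y <-> forall x, 0 <= bary K y x.
Proof.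
move=> Kn; split; first by move=> /(simplex_bary Kn.2)[].
move=> y0; have [b1 by_] := bary_total Kn y.
by exists (bary K y).
Qed.

Lemma near_notin_simplex (K : {fset 'rV[R]_d}) x : nondegenerate_simplex K ->
  ~ simplex K x -> \forall y \near x, ~ simplex K y.
Proof.
move=> Kn /(simplex_baryE x Kn)/existsNP[z /negP]; rewrite -ltNge => zx.
have cz := continuous_polyfun (polyfun_bary Kn z) (x := x).
near=> y; move=> /(simplex_baryE y Kn)/(_ z); apply/negP; rewrite -ltNge.
by near: y; exact: (cvgr_lt _ cz).
Unshelve. all: by end_near. Qed.

Variables (Omega : set 'rV[R]_d) (T : set {fset 'rV[R]_d}).
Hypothesis Omega_open : open Omega.
Hypothesis T_simplex : forall K, T K -> nondegenerate_simplex K.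
Hypothesis T_cover : Omega `<=` \bigcup_(K in T) simplex K.
Hypothesis T_locfin : forall y : 'rV[R]_d, exists2 U, nbhs y U &
  finite_set [set K | T K /\ simplex K `&` U !=set0].

Let star x := [set K | T K /\ simplex K x].

Lemma finite_star x : finite_set (star x).
Proof.
have [U xU fU] := T_locfin x; apply: sub_finite_set fU => K [TK Kx].
by split=> //; exists x; split=> //; exact: nbhs_singleton.
Qed.

(** Simplices are closed and locally finite in number, so those that miss x stay away from a
    neighbourhood of x. *)
Lemma near_star x : Omega x ->
  \forall y \near x, Omega y /\ exists2 K, star x K & simplex K y.
Proof.

move=> Ox; have [U xU fU] := T_locfin x.
have /finite_fsetP[X XE] := fU.
have H : nbhs x (\bigcap_(K in [set` X]) [set y | ~ simplex K x -> ~ simplex K y]).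
  apply: filter_bigI => K KX.
  have [TK _] : [set K | T K /\ simplex K `&` U !=set0] K by rewrite XE.
  have [Kx|nKx] := pselect (simplex K x); first by near=> y => /(_ Kx).
  have nK := near_notin_simplex (T_simplex TK) nKx.
  by near=> y => _; near: y.
near=> y.
have Oy : Omega y by near: y; exact: open_nbhs_nbhs.
split=> //; have [K TK Ky] := T_cover Oy; exists K => //; split=> //.
apply: contrapT => nKx.
have HX : (\bigcap_(K in [set` X]) [set y | ~ simplex K x -> ~ simplex K y]) y by near: y.
have KX : [set` X] K.
  by rewrite -XE; split=> //; exists y; split=> //; near: y.
exact: (HX K KX nKx Ky).
Unshelve. all: by end_near. Qed.

Lemma continuous_glue (p : {fset 'rV[R]_d} -> 'rV[R]_d -> R) (w : 'rV[R]_d -> R) :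
  (forall K, T K -> continuous (p K)) ->
  (forall K x, T K -> Omega x -> simplex K x -> w x = p K x) ->
  forall x, Omega x -> {for x, continuous w}.
Proof.
move=> pc wp x Ox; change (w y @[y --> x] --> w x).
apply: (@cvg_finite_select R _ _ (nbhs x) (star x) p w (w x) _ (finite_star x)).
  by move=> K [TK Kx]; rewrite (wp K)//; exact: pc.
near=> y; have [Oy [K [TK Kx] Ky]] : Omega y /\ exists2 K, star x K & simplex K y.
  by near: y; exact: near_star.
by exists K => //; exact: wp.
Unshelve. all: by end_near. Qed.

(** Induction on m over all families p: the partial derivatives of the pieces are the pieces of that
    of w, and their differences lose one order of vanishing. *)
Lemma cont_diff_glue m (p : {fset 'rV[R]_d} -> 'rV[R]_d -> R) (w : 'rV[R]_d -> R) :
  (forall K, T K -> polyfun leq 0 (p K)) ->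
  (forall K x, T K -> Omega x -> simplex K x -> w x = p K x) ->
  (forall K K' x, T K -> T K' -> Omega x -> simplex K x -> simplex K' x ->
     polyfun leq m.+1 (fun v => p K (x + v) - p K' (x + v))) ->
  cont_diff m Omega w.
Proof.
have pc (q : {fset 'rV[R]_d} -> 'rV[R]_d -> R) :
    (forall K, T K -> polyfun leq 0 (q K)) -> forall K, T K -> continuous (q K).
  by move=> pq K TK; exact: continuous_polyfun (pq K TK).
elim: m p w => [|m IH] p w pp wp pv /=; split=> //.
- exact: continuous_glue (pc p pp) wp.
- exact: continuous_glue (pc p pp) wp.
move=> i; pose e : 'rV[R]_d := delta_mx 0 i.
have dp K x : T K -> derivable (p K) x e.
  by move=> TK; apply/diff_derivable/(differentiable_polyfun x (pp K TK)).
have derB K K' x v : T K -> T K' ->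
    'D_e (p K) (x + v) - 'D_e (p K') (x + v) =
    'D_e (fun v => p K (x + v) - p K' (x + v)) v.
  move=> TK TK'; rewrite -deriveB; [|exact: dp|exact: dp].
  by apply: (derive_transfer _).1 => h; rewrite addrCA.
have agree K K' x : T K -> T K' -> Omega x -> simplex K x -> simplex K' x ->
    polyfun leq m.+1 (fun v => 'D_e (p K) (x + v) - 'D_e (p K') (x + v)).
  move=> TK TK' Ox Kx K'x; have := polyfun_derive i (pv K K' x TK TK' Ox Kx K'x).
  by apply: eq_polyfun => v; rewrite derB.
have agree0 K K' x : T K -> T K' -> Omega x -> simplex K x -> simplex K' x ->
    'D_e (p K) x = 'D_e (p K') x.
  move=> TK TK' Ox Kx K'x; apply/eqP; rewrite -subr_eq0; apply/eqP.
  by have := polyfun_at0 (agree K K' x TK TK' Ox Kx K'x); rewrite addr0.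
(* For small h the point x + h e lies in some simplex through x, so the quotient of w is that of one
   of finitely many pieces, all with the same derivative at x. *)
have wlim K x : T K -> Omega x -> simplex K x ->
    (fun h : R => h^-1 *: ((w \o shift x) (h *: e) - w x)) h @[h --> 0^'] --> 'D_e (p K) x.
  move=> TK Ox Kx.
  apply: (@cvg_finite_select R R _ (dnbhs (0 : R)) (star x)
      (fun K (h : R) => h^-1 *: ((p K \o shift x) (h *: e) - p K x))
      (fun h : R => h^-1 *: ((w \o shift x) (h *: e) - w x))
      ('D_e (p K) x) _ (finite_star x)).
    move=> K' [TK' K'x]; rewrite (agree0 K K' x)//; exact: dp.
  have near_h : (fun h : R => h *: e + x) h @[h --> (0 : R)] --> x.
    rewrite -[X in _ --> X]add0r -[X in _ --> X + x](scale0r e).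
    by apply: cvgD; [apply: cvgZl; exact: cvg_id|exact: cvg_cst].
  have := near_h _ (near_star Ox); rewrite nbhs_filterE /= => nh.
  apply: cvg_within; apply: filterS nh => h [Oh [K' [TK' K'x] K'h]].
  by exists K' => //=; rewrite (wp K')// (wp K' x).
split=> [x Ox|].
  have [K TK Kx] := T_cover Ox.
  by apply/cvg_ex; exists ('D_e (p K) x); exact: wlim.
apply: (IH (fun K => 'D_e (p K))) => //.
- by move=> K TK; exact: polyfun_derive_dir (pp K TK).
- by move=> K x TK Ox Kx; apply: cvg_lim => //; exact: wlim.
Qed.

End simplex_topology.

Section local_finiteness.
Context {R : realType} {d : nat}.
Variable T : set {fset 'rV[R]_d}.
Hypothesis T_locfin : forall y : 'rV[R]_d, exists2 U, nbhs y U &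
  finite_set [set K | T K /\ simplex K `&` U !=set0].

Lemma finite_meet_compact (C : set 'rV[R]_d) : compact C ->
  finite_set [set K | T K /\ simplex K `&` C !=set0].
Proof.
rewrite compact_cover => Cc.
have [U UP] : exists U : 'rV[R]_d -> set 'rV[R]_d, forall y,
    nbhs y (U y) /\ finite_set [set K | T K /\ simplex K `&` U y !=set0].
  exists (fun y => s2val (cid2 (T_locfin y))) => y.
  by case: (cid2 (T_locfin y)) => U yU fU; split.
have [D _ CD] := Cc _ [set: 'rV[R]_d] (fun y => (U y)°) (fun y _ => @open_interior _ _)
  (fun y _ => ex_intro2 _ _ y I (UP y).1).
apply: (@sub_finite_set _ _
  (\bigcup_(y in [set` D]) [set K | T K /\ simplex K `&` U y !=set0])).
  move=> K [TK [y [Ky Cy]]]; have [z Dz Uz] := CD y Cy.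
  by exists z => //; split=> //; exists y; split=> //; exact: interior_subset.
by apply: bigcup_finite => [|y _]; [exact: finite_fset|exact: (UP y).2].
Qed.

(** Each compact cube [C n] meets finitely many simplices and every simplex meets some [C n], so the
    exceptional sets reduce to a countable union. *)
Lemma ae_locally_finite (P : {fset 'rV[R]_d} -> d.-tuple R -> Prop) :
  (forall K, T K -> simplex K !=set0) ->
  (forall K, T K -> {ae lebesgue_tuple d, forall t, P K t}) ->
  {ae lebesgue_tuple d, forall t, forall K, T K -> P K t}.
Proof.
move=> T0 PT.
pose C (n : nat) : set 'rV[R]_d := [set v | forall i, `[- n%:R, n%:R]%classic (v ord0 i)].
have fC n : finite_set [set K | T K /\ simplex K `&` C n !=set0].
  apply: finite_meet_compact.
  exact: (@rV_compact R d (fun=> `[- n%:R, n%:R]%classic) (fun=> @segment_compact _ _ _)).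
have : {ae lebesgue_tuple d, forall t, forall n, forall K,
    T K /\ simplex K `&` C n !=set0 -> P K t}.
  apply: ae_foralln => n; have /finite_fsetP[X XE] := fC n.
  have H : almost_everywhere (lebesgue_tuple d) (\bigcap_(K in [set` X]) [set t | P K t]).
    apply: filter_bigI => K KX; apply: PT.
    by have : [set` X] K by []; rewrite -XE => -[].
  apply: filterS H => t Xt K TKC; apply: Xt.
  by have : [set K | T K /\ simplex K `&` C n !=set0] K by []; rewrite XE.
apply: filterS => t H K TK.
have [y Ky] := T0 K TK.
have [n yn] : exists n : nat, forall i, `|y ord0 i| <= n%:R.
  exists (\max_(i < d) Num.bound `|y ord0 i|)%N => i.
  apply: le_trans (ltW (archi_boundP (normr_ge0 _))) _.
  rewrite ler_nat; exact: (@leq_bigmax _ (fun i => Num.bound `|y ord0 i|) i).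
apply: (H n); split=> //; exists y; split=> // i.
by rewrite /= in_itv /= -ler_norml.
Qed.

End local_finiteness.

(** * Unisolvence and regularity of the global space *)

Section main.
Context {R : realType} {d : nat}.
Variables (r : nat -> nat) (k : nat) (Omega : set 'rV[R]_d)
  (T : set {fset 'rV[R]_d}) (nu : forall F : {fset 'rV[R]_d}, 'M[R]_(codim F, d)).
Hypothesis r_growth : forall i, (1 <= i < d)%N ->
  (2 ^ (d - i) * r i <= 2 ^ (d - i.+1) * r i.+1)%N.
Hypothesis k_large : (2 * r d + 1 <= k)%N.

Lemma unisolvent_simplex K : nondegenerate_simplex K ->
  (forall F, subsimplex F K -> is_normal_frame (nu F)) -> unisolvent nu r k K.
Proof.
move=> Kn nuK; split; first exact: num_dofsE.
move=> u /(bernstein_expansion Kn)[c cdeg ->] dof0.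
have K0 : K != fset0 by rewrite -cardfs_gt0 Kn.1.
have KK : subsimplex K K by split.
have vanish := face_induction r_growth k_large Kn nuK cdeg (fsubset_refl K)
  (fun F FK n theta v => dof0 F n theta v FK) KK.
apply/funext => y; rewrite big1// => al _.
have [->|/vanish] := eqVneq (c al) 0; first by rewrite mul0r.
(* On [K] itself the normal degree is an empty sum, so the strict bound of [vanish] is
   impossible. *)
by rewrite /normal_degree big1 ?ltn0// => x; rewrite fsvalP.
Qed.

Hypothesis tri : conforming_triangulation Omega T.
Hypothesis nuT : forall K F, T K -> subsimplex F K -> is_normal_frame (nu F).

Lemma poly_agree (p : {fset 'rV[R]_d} -> 'rV[R]_d -> R) K K' x :
  (forall K, T K -> poly_space k (p K)) ->
  (forall K K' F, T K -> T K' -> subsimplex F K -> subsimplex F K' ->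
     (#|` F| <= d)%N -> same_dofs nu r k F (p K) (p K')) ->
  T K -> T K' -> simplex K x -> simplex K' x ->
  polyfun leq (r 1%N).+1 (fun v => p K (x + v) - p K' (x + v)).
Proof.
case: tri => Tn _ Tconf _ pk pdof TK TK' Kx K'x.
have [e|[F [FK FK' FE]]] := Tconf K K' TK TK'.
  by have : (simplex K `&` simplex K') x by []; rewrite e.
have [FKs F0] := FK; have [FK's _] := FK'.
(* A common face with d + 1 vertices is all of [K] and all of [K'], so the two polynomials are the
   same. *)
have [dF|Fd] := ltnP d #|` F|.
  have eqF L : T L -> (F `<=` L)%fset -> F = L.
    move=> TL FL; apply/eqP; rewrite eqEfcard FL.
    by rewrite (Tn L TL).1.
  rewrite -(eqF K)// -(eqF K')//.
  by apply: eq_polyfun (polyfun0 _ _) => v; rewrite subrr.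
have Kn := Tn K TK.
have pp L : T L -> polyfun leq 0 (p L).
  by move=> TL; have := pk L TL; rewrite poly_spaceE; exact: polyfun_weaken.
pose u y := p K y - p K' y.
have uk : poly_space k u.
  rewrite poly_spaceE; have := pk K TK; have := pk K' TK'; rewrite !poly_spaceE => q' q.
  exact: polyfunB q q'.
have [c cdeg uE] := bernstein_expansion Kn uk.
have nuK G : subsimplex G K -> is_normal_frame (nu G) by exact: nuT TK.
have dof0 G : subsimplex G F -> forall n (theta : 'I_(codim G) -> nat) v,
    (n <= max_order r (codim G))%N -> (\sum_j theta j)%N = n ->
    bubble r k G n v -> dof nu theta (fun y => \sum_al c al * bern al y) v = 0.
  move=> [GF G0] n theta v nr thn vb.
  have GK : (G `<=` K)%fset := fsubset_trans GF FKs.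
  have GK' : (G `<=` K')%fset := fsubset_trans GF FK's.
  have Gi := aff_indep_sub GK Kn.2.
  have Gd : (#|` G| <= d)%N by apply: leq_trans Fd; exact: fsubset_leq_card.
  have := pdof K K' G TK TK' (conj GK G0) (conj GK' G0) Gd n theta v nr thn vb.
  rewrite /dof -uE /u => e.
  have [q qB] := normal_derive_polyfun_closed (nu G) theta (pp K TK) (pp K' TK').
  have [q' _] := normal_derive_polyfun_closed (nu G) theta (pp K' TK') (pp K TK).
  rewrite qB face_pairingB//; first by rewrite e subrr.
  - exact: face_poly_polyfun q.
  - exact: face_poly_polyfun q'.
  - exact: face_poly_bubble vb.
have xF : simplex F x by rewrite -FE.
have vanish := face_induction r_growth k_large Kn nuK cdeg FKs dof0 (conj (fsubset_refl F) F0).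
apply: (@eq_polyfun _ _ _ _ (fun v => \sum_al c al * bern al (x + v *m 1%:M))).
  by move=> v; rewrite mulmx1 -[RHS]/(u (x + v)) uE.
apply: polyfun_sum => al _; have [->|cal] := eqVneq (c al) 0.
  by apply: eq_polyfun (polyfun0 _ _) => v; rewrite mul0r.
apply: polyfunZ; apply: polyfun_weaken (polyfun_bern_frame Kn FKs 1%:M al xF) => b.
apply: leq_trans; apply: leq_trans (vanish al cal).
rewrite ltnS /max_order; have cF : (1 <= codim F <= d)%N.
  by rewrite /codim; move: F0 Fd; rewrite -cardfs_gt0; lia.
by case: (codim F) cF => // c' /andP[_ cd]; exact: (order_mono r_growth).
Qed.

Lemma fe_space_cont_diff u : is_domain Omega -> fe_space r k nu Omega T u ->
  exists2 w, cont_diff (r 1%N) Omega w & ae_eq_on Omega u w.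
Proof.
move=> [Oo _ _] [_ [p [pT pdof]]]; case: (tri) => Tn Tcov Tconf Tloc.
have pk K : T K -> poly_space k (p K) by move=> /pT[].
have agree := poly_agree pk pdof.
(* Any simplex through x gives the same value, because the polynomials agree on intersections. *)
pose w x := p (xget fset0 [set K | T K /\ simplex K x]) x.
have wp K x : T K -> simplex K x -> w x = p K x.
  move=> TK Kx; have [TL Lx] : [set K | T K /\ simplex K x]
      (xget fset0 [set K | T K /\ simplex K x]).
    by apply: xgetPex; exists K.
  apply/eqP; rewrite -subr_eq0 /w; apply/eqP; move: (xget _ _) TL Lx => L TL Lx.
  by have := polyfun_at0 (agree L K x TL TK Lx Kx); rewrite addr0.
exists w.
  apply: (cont_diff_glue Oo Tn _ Tloc (p := p)).
  - by rewrite -Tcov; exact: subset_closure.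
  - by move=> K TK; have := pk K TK; rewrite poly_spaceE; exact: polyfun_weaken.
  - by move=> K x TK _; exact: wp.
  - by move=> K K' x TK TK' _; exact: agree.
have T0 K : T K -> simplex K !=set0.
  move=> TK; have : K != fset0 by rewrite -cardfs_gt0 (Tn K TK).1.
  by move=> /fset0Pn[x xK]; exists x; exact: (vertex_simplex [` xK]%fset).
have := ae_locally_finite Tloc T0 (fun K TK => (pT K TK).2).
apply: filterS => t H Ot.
have [K TK Kt] : (\bigcup_(K in T) simplex K) (row_of_tuple t).
  by rewrite -Tcov; exact: subset_closure.
by rewrite (H K TK)// (wp K).
Qed.

End main.

Theorem theorem3p3 (R : realType) (d : nat) (r : nat -> nat) (k : nat)
    (Omega : set 'rV[R]_d) (T : set {fset 'rV[R]_d})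
    (nu : forall F : {fset 'rV[R]_d}, 'M[R]_(codim F, d)) :
  (1 <= d)%N ->
  (forall i, (1 <= i < d)%N ->
     (2 ^ (d - i) * r i <= 2 ^ (d - i.+1) * r i.+1)%N) ->
  (2 * r d + 1 <= k)%N ->
  is_domain Omega ->
  conforming_triangulation Omega T ->
  (forall K F, T K -> subsimplex F K -> is_normal_frame (nu F)) ->
  (forall K, T K -> unisolvent nu r k K) /\
  (forall u, fe_space r k nu Omega T u ->
     exists2 w, cont_diff (r 1%N) Omega w & ae_eq_on Omega u w).
Proof.
move=> _ r_growth k_large dom tri nuT; split=> [K TK|u].
  apply: unisolvent_simplex => // [|F]; last exact: nuT TK.
  by case: tri => /(_ K TK).
exact: fe_space_cont_diff.
Qed.
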